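(* Let $k\geq 2$, and let $G=\Gamma_k\ltimes\mathbb{R}^2$ and $H=\Gamma^z\ltimes\mathbb{R}^2$. Then $E(G)<_B E(H)$, but there is no topological isomorphism $\phi:G_0\to H_0$ such that $\phi\,\mathrm{Inn}_G(G_0)\,\phi^{-1}\subseteq\mathrm{Inn}_H(H_0)$.
   Context: For $t\in\mathbb{R}$ let $R(t)=\begin{pmatrix}\cos(2\pi t)&-\sin(2\pi t)\\ \sin(2\pi t)&\cos(2\pi t)\end{pmatrix}$. Put $\Gamma^z=\{R(\sqrt{2}\,n):n\in\mathbb{Z}\}$ and, for $k\geq 2$, $\Gamma_k=\{R(i/k): 0\le i\leq k\}$ (the group of rotations by multiples of $2\pi/k$). For a countable subgroup $\Lambda$ of $\mathrm{GL}(2,\mathbb{R})$ with the discrete topology, $\Lambda\ltimes\mathbb{R}^2$ is the set $\Lambda\times\mathbb{R}^2$ with the product topology and the group operation $(A_1,t_1)(A_2,t_2)=(A_1A_2,\,t_1+A_1t_2)$; it is a Polish group. For a Polish group $G$, $E(G)$ is the equivalence relation on $G^\omega$ defined by: $x\,E(G)\,y$ iff $\lim_n x(n)y(n)^{-1}$ converges in $G$. For Borel equivalence relations $E,F$ on Polish spaces $X,Y$, $E\leq_B F$ means there is a Borel map $\theta:X\to Y$ with $xEy\iff\theta(x)F\theta(y)$ for all $x,y\in X$; $E<_B F$ means $E\leq_B F$ and not $F\leq_B E$. $G_0$ is the identity component (connected component of $1_G$) of $G$. For $u\in G$, $\iota_u:G_0\to G_0$ is $\iota_u(g)=ugu^{-1}$,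 and $\mathrm{Inn}_G(G_0)=\{\iota_u:u\in G\}$; similarly for $H$. $\phi\,\mathrm{Inn}_G(G_0)\,\phi^{-1}=\{\phi\circ\iota_u\circ\phi^{-1}:u\in G\}$. *)

(* Defs.v *)
From HB Require Import structures.
From mathcomp Require Import all_boot all_order all_algebra.
From mathcomp Require Import all_classical all_reals all_analysis.
From mathcomp Require Import ring.

Set Implicit Arguments.
Unset Strict Implicit.
Unset Printing Implicit Defensive.

Import Order.TTheory GRing.Theory Num.Theory.
Import numFieldNormedType.Exports.

Local Open Scope classical_set_scope.
Local Open Scope ring_scope.

(* Pointedness is no restriction, a group being pointed by its unit; it makes
   [cvg] and [g_sigma_algebraType] available. *)
HB.mixin Record isTopologicalGroup G & Group G & PointedTopological G := {
  mulg_continuous : continuous (fun xy : G * G => (xy.1 * xy.2)%g);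
  invg_continuous : continuous (fun x : G => (x^-1)%g)
}.

#[short(type="topologicalGroupType")]
HB.structure Definition TopologicalGroup :=
  {G of isTopologicalGroup G & Group G & PointedTopological G}.

Definition borel_map (X Y : ptopologicalType) (f : X -> Y) : Prop :=
  @measurable_fun _ _ (g_sigma_algebraType (@open X))
    (g_sigma_algebraType (@open Y)) setT f.

Definition borel_reducible (X Y : ptopologicalType)
    (E : X -> X -> Prop) (F : Y -> Y -> Prop) : Prop :=
  exists2 theta : X -> Y, borel_map theta &
    forall x y, E x y <-> F (theta x) (theta y).

Definition strictly_borel_reducible (X Y : ptopologicalType)
    (E : X -> X -> Prop) (F : Y -> Y -> Prop) : Prop :=
  borel_reducible E F /\ ~ borel_reducible F E.

HB.instance Definition _ (I : Type) (T : I -> ptopologicalType) :=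
  isPointed.Build (prod_topology T) (fun=> point).

(* [{ptws nat -> G}] is G^omega with the product topology. *)
Definition E_rel (G : topologicalGroupType) (x y : {ptws nat -> G}) : Prop :=
  cvgn (fun n => (x n * (y n)^-1)%g).

Section IdentityComponent.
Variable G : topologicalGroupType.

Definition identity_component_set : set G :=
  connected_component [set: G] 1%g.

Local Notation G0 := identity_component_set.

Lemma mulgr_continuous (u : G) : continuous (fun x : G => (u * x)%g).
Proof.
move=> x; apply: (@continuous_comp _ _ _ (fun x : G => (u, x))
  (fun xy : G * G => (xy.1 * xy.2)%g)); last exact: mulg_continuous.
by apply: cvg_pair => /=; [exact: cvg_cst|exact: cvg_id].
Qed.

Lemma mulgl_continuous (u : G) : continuous (fun x : G => (x * u)%g).
Proof.
move=> x; apply: (@continuous_comp _ _ _ (fun x : G => (x, u))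
  (fun xy : G * G => (xy.1 * xy.2)%g)); last exact: mulg_continuous.
by apply: cvg_pair => /=; [exact: cvg_id|exact: cvg_cst].
Qed.

Lemma identity_component1 : G0 1%g.
Proof. exact: connected_component_refl. Qed.

Lemma image_identity_component (f : G -> G) :
  continuous f -> G0 (f 1%g) -> forall x, G0 x -> G0 (f x).
Proof.
move=> fc f1 x G0x; apply: (connected_component_trans f1).
exists (f @` G0); last by exists x.
split=> //; first by exists 1%g => //; exact: identity_component1.
apply: connected_continuous_connected; first exact: component_connected.
exact: continuous_subspaceT.
Qed.

Lemma identity_componentV x : G0 x -> G0 (x^-1)%g.
Proof.
apply: (image_identity_component (@invg_continuous G)).
by rewrite invg1; exact: identity_component1.
Qed.

Lemma identity_componentM x y : G0 x -> G0 y -> G0 (x * y)%g.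
Proof.
move=> G0x; apply: (image_identity_component (@mulgr_continuous x)).
by rewrite mulg1.
Qed.

Lemma identity_componentJ u x : G0 x -> G0 (u * x * u^-1)%g.
Proof.
apply: (@image_identity_component (fun x => (u * x * u^-1)%g)).
  move=> z; apply: (@continuous_comp _ _ _ (fun x : G => (u * x)%g)
    (fun x : G => (x * u^-1)%g)); first exact: mulgr_continuous.
  exact: mulgl_continuous.
by rewrite mulg1 mulgV; exact: identity_component1.
Qed.

Lemma identity_component_group_closed :
  group_closed (fun x : G => x \in G0).
Proof.
split; first exact/mem_set/identity_component1.
move=> x y /set_mem G0x /set_mem G0y; apply/mem_set.
by apply: identity_componentM => //; exact: identity_componentV.
Qed.

Definition identity_component : Type := set_type G0.

HB.instance Definition _ := SubChoice.on identity_component.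
HB.instance Definition _ := Topological.on identity_component.
HB.instance Definition _ :=
  SubChoice_isSubGroup.Build G (fun x => x \in G0) identity_component
    identity_component_group_closed.
HB.instance Definition _ := isPointed.Build identity_component 1%g.

Let val0 : identity_component -> G := @set_val G G0.

Let val0_continuous : continuous val0.
Proof. exact: initial_continuous. Qed.

Let mul_continuous : continuous
  (fun xy : identity_component * identity_component => (xy.1 * xy.2)%g).
Proof.
apply: continuous_comp_initial => -[x y].
apply: (@continuous_comp _ _ _
  (fun xy : identity_component * identity_component => (val0 xy.1, val0 xy.2))
  (fun xy : G * G => (xy.1 * xy.2)%g)); last exact: mulg_continuous.
apply: cvg_pair => /=.
  by apply: (cvg_comp fst val0); [exact: cvg_fst|exact: val0_continuous].
by apply: (cvg_comp snd val0); [exact: cvg_snd|exact: val0_continuous].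
Qed.

Let inv_continuous : continuous (fun x : identity_component => (x^-1)%g).
Proof.
apply: continuous_comp_initial => x.
apply: (@continuous_comp _ _ _ val0 (fun x : G => (x^-1)%g)).
  exact: val0_continuous.
exact: invg_continuous.
Qed.

HB.instance Definition _ :=
  isTopologicalGroup.Build identity_component mul_continuous inv_continuous.

Definition iota_conj (u : G) (g : identity_component) : identity_component :=
  exist _ (u * val g * u^-1)%g
    (mem_set (identity_componentJ u (set_mem (valP g)))).

Definition Inn : set (identity_component -> identity_component) :=
  range iota_conj.

End IdentityComponent.

Definition topological_isomorphism (G H : topologicalGroupType)
    (phi : G -> H) (phiV : H -> G) : Prop :=
  [/\ {morph phi : x y / (x * y)%g >-> (x * y)%g},
      cancel phi phiV, cancel phiV phi, continuous phi & continuous phiV].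

Record gl2_subgroup (R : realType) := Gl2Subgroup {
  gl2_set :> set 'M[R]_2;
  gl2_set_unit : forall A, gl2_set A -> A \in unitmx;
  gl2_set1 : gl2_set 1%:M;
  gl2_setM : forall A B, gl2_set A -> gl2_set B -> gl2_set (A *m B);
  gl2_setV : forall A, gl2_set A -> gl2_set (invmx A);
  gl2_set_countable : countable gl2_set
}.

Section Semidirect.
Variables (R : realType) (L : gl2_subgroup R).

Definition semidirect : Type :=
  (discrete_topology (set_type L) * 'cV[R]_2)%type.

HB.instance Definition _ := Topological.copy semidirect
  (discrete_topology (set_type L) * 'cV[R]_2)%type.

Let one2 : set_type L := exist _ 1%:M (mem_set (gl2_set1 L)).
Let mul2 (A B : set_type L) : set_type L :=
  exist _ (val A *m val B)
    (mem_set (gl2_setM (set_mem (valP A)) (set_mem (valP B)))).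
Let inv2 (A : set_type L) : set_type L :=
  exist _ (invmx (val A)) (mem_set (gl2_setV (set_mem (valP A)))).

Definition sd_one : semidirect := (one2, 0).
Definition sd_mul (x y : semidirect) : semidirect :=
  (mul2 x.1 y.1, x.2 + val x.1 *m y.2).
Definition sd_inv (x : semidirect) : semidirect :=
  (inv2 x.1, - (invmx (val x.1) *m x.2)).

Let valU (A : set_type L) : val A \in unitmx.
Proof. exact: (gl2_set_unit (set_mem (valP A))). Qed.

Lemma sd_mulA : associative sd_mul.
Proof.
move=> x y z; congr pair; first by apply: val_inj; rewrite /= mulmxA.
by rewrite /= mulmxDr mulmxA addrA.
Qed.

Lemma sd_mul1 : left_id sd_one sd_mul.
Proof.
move=> [A t]; congr pair; first by apply: val_inj; rewrite /= mul1mx.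
by rewrite /= mul1mx add0r.
Qed.

Lemma sd_mulr1 : right_id sd_one sd_mul.
Proof.
move=> [A t]; congr pair; first by apply: val_inj; rewrite /= mulmx1.
by rewrite /= mulmx0 addr0.
Qed.

Lemma sd_mulV : left_inverse sd_one sd_inv sd_mul.
Proof.
move=> [A t]; congr pair; first by apply: val_inj; rewrite /= mulVmx ?valU.
by rewrite /= addNr.
Qed.

Lemma sd_mulrV : right_inverse sd_one sd_inv sd_mul.
Proof.
move=> [A t]; congr pair; first by apply: val_inj; rewrite /= mulmxV ?valU.
by rewrite /= mulmxN mulKVmx ?valU ?subrr.
Qed.

HB.instance Definition _ := isGroup.Build semidirect
  sd_mulA sd_mul1 sd_mulr1 sd_mulV sd_mulrV.
HB.instance Definition _ := isPointed.Build semidirect sd_one.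

Lemma mulmxr_continuous (A : 'M[R]_2) :
  continuous (fun t : 'cV[R]_2 => A *m t).
Proof.
move=> t U [P Pt sPU].
suff: nbhs t [set s : 'cV[R]_2 | forall i j, P i j ((A *m s) i j)].
  by apply: filterS => s; exact: sPU.
have FF : Filter (nbhs t) by exact: nbhs_filter.
apply: (filter_forall FF) => i; apply: (filter_forall FF) => j.
suff: (fun s : 'cV[R]_2 => (A *m s) i j) @ t --> (A *m t) i j.
  by apply; exact: Pt.
have -> : (fun s : 'cV[R]_2 => (A *m s) i j) =
    (fun s => A i ord0 * s ord0 j + A i ord_max * s ord_max j).
  apply/funext => s; rewrite mxE !big_ord_recl big_ord0 addr0.
  by congr (_ + A i _ * s _ j); apply: val_inj.
have -> : (A *m t) i j = A i ord0 * t ord0 j + A i ord_max * t ord_max j.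
  rewrite mxE !big_ord_recl big_ord0 addr0.
  by congr (_ + A i _ * t _ j); apply: val_inj.
by apply: cvgD; apply: cvgM; by [exact: cvg_cst|exact: coord_continuous].
Qed.

Lemma fst_near (x : semidirect) : \forall y \near x, y.1 = x.1.
Proof.
have h : (fst : discrete_topology (set_type L) * 'cV[R]_2 -> _) @ x --> x.1.
  exact: cvg_fst.
exact: (h _ (discrete_set1 x.1)).
Qed.

Let snd_cvg (x : semidirect) : (fun y : semidirect => y.2) @ x --> x.2.
Proof. exact: (@cvg_snd _ _ (nbhs x.1) (nbhs x.2)). Qed.

Let semidirect_cvg (T : topologicalType) (f : T -> semidirect) (x : T) :
  (\forall y \near x, (f y).1 = (f x).1) ->
  (fun y => (f y).2) @ x --> (f x).2 -> f @ x --> f x.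
Proof.
move=> f1 f2; have -> : f = (fun y => ((f y).1, (f y).2)).
  by apply/funext => y; case: (f y).
apply: (@cvg_pair _ _ _ _ (nbhs (f x).1) (nbhs (f x).2)) => //=.
by apply/discrete_cvg; exact: f1.
Qed.

Lemma sd_mul_continuous :
  continuous (fun xy : semidirect * semidirect => (xy.1 * xy.2)%g).
Proof.
move=> [x y]; have near1 : \forall xy \near (x, y), xy.1.1 = x.1.
  exact: (@cvg_fst _ _ (nbhs x) (nbhs y) _ _ (fst_near x)).
have near2 : \forall xy \near (x, y), xy.2.1 = y.1.
  exact: (@cvg_snd _ _ (nbhs x) (nbhs y) _ _ (fst_near y)).
apply: semidirect_cvg.
  by apply: filterS2 near1 near2 => -[x' y'] /= e1 e2; congr mul2.
apply: cvg_trans (_ : (fun xy : semidirect * semidirect =>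
    xy.1.2 + val x.1 *m xy.2.2) @ (x, y) --> _).
  by apply: near_eq_cvg; apply: filterS near1 => -[x' y'] /= ->.
apply: cvgD.
  apply: (@continuous_comp _ _ _ fst (fun x : semidirect => x.2)).
    exact: cvg_fst.
  exact: snd_cvg.
apply: (@continuous_comp _ _ _ (fun xy : semidirect * semidirect => xy.2.2)).
  apply: (@continuous_comp _ _ _ snd (fun x : semidirect => x.2)).
    exact: cvg_snd.
  exact: snd_cvg.
exact: mulmxr_continuous.
Qed.

Lemma sd_inv_continuous : continuous (fun x : semidirect => (x^-1)%g).
Proof.
move=> x; apply: semidirect_cvg.
  by apply: filterS (fst_near x) => y e; congr inv2.
apply: cvg_trans (_ : (fun y : semidirect =>
    - (invmx (val x.1) *m y.2)) @ x --> _).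
  by apply: near_eq_cvg; apply: filterS (fst_near x) => y /= ->.
apply: cvgN.
apply: (@continuous_comp _ _ _ (fun y : semidirect => y.2)).
  exact: snd_cvg.
exact: mulmxr_continuous.
Qed.

HB.instance Definition _ :=
  isTopologicalGroup.Build semidirect sd_mul_continuous sd_inv_continuous.

End Semidirect.

Section Rotations.
Variable R : realType.

Definition rot_mx (t : R) : 'M[R]_2 :=
  \matrix_(i, j)
    if i == j then cos (2 * pi * t)
    else if (i < j)%N then - sin (2 * pi * t) else sin (2 * pi * t).

Lemma rotD s t : rot_mx s *m rot_mx t = rot_mx (s + t).
Proof.
apply/matrixP => i j; rewrite !mxE !big_ord_recl big_ord0 addr0 !mxE.
move: (2 * pi) => c; rewrite (mulrDr c) cosD sinD.
by case: i => -[|[|//]] iP; case: j => -[|[|//]] jP;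
  rewrite /=; ring.
Qed.

Lemma rot0 : rot_mx 0 = 1%:M.
Proof.
apply/matrixP => i j; rewrite !mxE mulr0 cos0 sin0 oppr0 if_same.
by case: eqVneq.
Qed.

Lemma rotD1 t : rot_mx (t + 1) = rot_mx t.
Proof.
have e : 2 * pi * (t + 1) = 2 * pi * t + pi *+ 2 :> R.
  by rewrite mulrDr mulr1 (mulr_natl pi 2).
by apply/matrixP => i j; rewrite !mxE e cosD2pi sinD2pi.
Qed.

Lemma rot_unit t : rot_mx t \in unitmx.
Proof.
by apply: (proj1 (@mulmx1_unit _ _ _ (rot_mx (- t)) _)); rewrite rotD subrr rot0.
Qed.

Lemma rotV t : invmx (rot_mx t) = rot_mx (- t).
Proof.
by rewrite -[RHS](mulKmx (rot_unit t)) rotD subrr rot0 mulmx1.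
Qed.

Definition Gamma_set (k : nat) : set 'M[R]_2 :=
  [set rot_mx (i%:R / k%:R) | i in [set i | (i <= k)%N]].

Definition Gammaz_set : set 'M[R]_2 :=
  [set rot_mx (Num.sqrt 2 * n%:~R) | n in [set: int]].

Lemma Gamma_setM k A B :
  Gamma_set k A -> Gamma_set k B -> Gamma_set k (A *m B).
Proof.
move=> [i /= ik <-] [j /= jk <-]; rewrite rotD -mulrDl -natrD.
have [ijk|kij] := leqP (i + j) k; first by exists (i + j)%N.
have k0 : k%:R != 0 :> R.
  by rewrite pnatr_eq0; case: k ik jk kij => // /[!leqn0] /eqP-> /eqP->.
exists (i + j - k)%N; first by rewrite /= leq_subLR leq_add.
by rewrite -rotD1 natrB ?(ltnW kij)// mulrBl divff// subrK.
Qed.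

Lemma Gamma_setV k A : Gamma_set k A -> Gamma_set k (invmx A).
Proof.
move=> [i /= ik <-]; rewrite rotV.
have [k0|k0] := eqVneq k 0%N.
  by exists 0%N => //; rewrite k0 invr0 !mulr0 oppr0.
have k0' : k%:R != 0 :> R by rewrite pnatr_eq0.
exists (k - i)%N; first exact: leq_subr.
by rewrite -[RHS]rotD1 natrB// mulrBl divff// addrC.
Qed.

Definition Gamma (k : nat) : gl2_subgroup R.
Proof.
apply: (@Gl2Subgroup R (Gamma_set k)).
- by move=> A [i _ <-]; exact: rot_unit.
- by exists 0%N => //; rewrite mul0r rot0.
- exact: Gamma_setM.
- exact: Gamma_setV.
- by apply: card_le_trans (card_image_le _ _) _; exact: countableP.
Defined.

Definition Gammaz : gl2_subgroup R.
Proof.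
apply: (@Gl2Subgroup R Gammaz_set).
- by move=> A [i _ <-]; exact: rot_unit.
- by exists 0 => //; rewrite mulr0 rot0.
- by move=> A B [m _ <-] [n _ <-]; exists (m + n) => //;
    rewrite rotD -mulrDr intrD.
- by move=> A [n _ <-]; exists (- n) => //; rewrite rotV intrN mulrN.
- by apply: card_le_trans (card_image_le _ _) _; exact: countableP.
Defined.

End Rotations.

(* Main.v *)
From HB Require Import structures.
Require Import Defs.
From mathcomp Require Import all_boot all_order all_algebra.
From mathcomp Require Import all_classical all_reals all_analysis.
From mathcomp Require Import lra ring zify.

(** Angles are measured in full turns; [G] is the semidirect product with the
plane of the group of rotations by multiples of [1 / k], [H] is the one of
the rotations by multiples of [sqrt 2], and elements are written [(A, t)].

[E(G)] reduces to [E(H)].  The rotations of [H] are dense in the circle but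
contain no nontrivial rotation of [G], so a rotation of [G] can only be
approximated.  For [x n = (A_n, s_n)] only the jumps [D_n = A_n^-1 A_(n+1)] are
replaced, each by a rotation [D'_n] of [H] at distance at most [2^-n]; with
[A'_n = D'_0 ... D'_(n-1)] the discrepancy [Q_n = A'_n A_n^-1] converges, the
errors being summable, and the reduction sends [x] to [(A'_n, Q_n s_n)]
([lift_seq]).  The jumps do not see a constant left factor of the [A_n], so two
sequences whose rotations have eventually constant ratio are sent to sequences
with the same property, and [Q_n] does not affect convergence of the
translation parts ([lift_seq_reduction]).

[E(H)] does not reduce to [E(G)].  Suppose that [theta] is a Borel reduction.
Sequences in [H] are given the prefix topology, in which [theta] has the Baire
property ([borel_map_Baire]), and one works at a single generic sequence [x]
and its translates by a countable group of eventually constant sequences.  Let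
[e_n(v)] be the sequence equal to the translation [v] from index [n] on and to
the unit before.  As [e_n(v) x] is [E(H)]-equivalent to [x], the quotients
[theta (e_n(v) x) m / theta x m] converge in [m]; call the limit the effect of
the step, and the largest distance of the quotients from [1] its bump.
- Small steps have small bumps ([small_steps]): otherwise summable steps, each
  with a large bump, add up to a convergent sequence whose image is not Cauchy.
- Conjugating [e_n(v)] by the [i]-th power of the generator of the rotations of
  [H] turns it into [e_n(v_i)] with [v_i] a rotated copy of [v], and it
  conjugates the effect by some element of [G].  Conjugation by elements of [G]
  acts on translations in at most [k] ways, so among the [k + 1] vectors
  [v_0, ..., v_k] two, say [v_i] and [v_i'], have nearly the same effect.  Then
  a step by [v_i'] together with a step by [- v_i] has almost no effect
  ([pair_at_x]).  That effects at different sequences can be compared at all is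
  what genericity is for ([hits_everywhere]).
- Repeating such pairs with [v] replaced by [2^-N v], one reaches the nonzero
  vector [w = v_i' - v_i] with arbitrarily small bump ([available_fixed]).
  Adding [w] infinitely often with summable bumps gives an unbounded sequence
  of translations whose effect on [theta] is nevertheless Cauchy
  ([obstruction]); so inequivalent sequences have equivalent images.
The argument uses of [G] only a bi-invariant metric, separability, total
boundedness of a ball and the finiteness of the conjugation action; of [H] only
its translations and one rotation ([no_Cauchy_reduction]).

There is no isomorphism.  The identity components are the planes of
translations ([component_eltE]), on which conjugation acts by the rotation
part.  The rotation by a [k]-th of a turn induces on [G_0] a nontrivial
automorphism of finite order, while a conjugation of [H] of finite order on
[H_0] is trivial, because [sqrt 2] is irrational. *)

Set Implicit Arguments.
Unset Strict Implicit.
Unset Printing Implicit Defensive.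

Import Order.TTheory GRing.Theory Num.Theory.
Import numFieldNormedType.Exports.

Local Open Scope classical_set_scope.
Local Open Scope ring_scope.

(** * Baire category in the space of sequences *)

Section PrefixTopology.
Variable S : Type.
Local Notation X := (nat -> S).
Implicit Types (x y z : X) (U C A : set X).

(** [S] is treated as discrete: the sequences agreeing with [x] below [n] are
the basic neighbourhoods of [x]. *)
Definition agree n x y := forall i, (i < n)%N -> x i = y i.

Lemma agreeC n x y : agree n x y -> agree n y x.
Proof. by move=> h i /h. Qed.

Lemma agree_trans n x y z : agree n x y -> agree n y z -> agree n x z.
Proof. by move=> h1 h2 i ni; rewrite h1 ?h2. Qed.

Lemma agreeW m n x y : (m <= n)%N -> agree n x y -> agree m x y.
Proof. by move=> mn h i im; apply/h/(leq_trans im). Qed.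

Definition prefix_open U := forall x, U x -> exists n, forall y,
    agree n x y -> U y.
Definition prefix_dense U := forall x n, exists2 y, agree n x y & U y.
Definition exterior U := [set x | exists n, forall y, agree n x y -> ~ U y].

Definition comeager C :=
  exists2 O : nat -> set X, forall l, prefix_open (O l) /\ prefix_dense (O l) &
    forall x, (forall l, O l x) -> C x.

Lemma exterior_open U : prefix_open (exterior U).
Proof.
move=> x [n h]; exists n => y xy; exists n => z yz.
exact/h/(agree_trans xy).
Qed.

Lemma dependent_sequence (T : Type) (t0 : T) (P : nat -> T -> T -> Prop) :
  (forall j t, exists t', P j t t') ->
  exists2 s : nat -> T, s 0%N = t0 & forall j, P j (s j) (s j.+1).
Proof.
move=> P_ex; have h j t := cid (P_ex j t).
exists (fix s n := if n is j.+1 then projT1 (h j (s j)) else t0) => // j.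
exact: (projT2 (h j _)).
Qed.

(** Fusion: approximations that are frozen on longer and longer prefixes have a
limit.  Since the prefix frozen at stage [j] has length at least [j], the limit
can be read off the diagonal. *)
Lemma agree_limit (y : nat -> X) (p : nat -> nat) :
  (forall j, agree (p j) (y j) (y j.+1)) -> (forall j, (p j <= p j.+1)%N) ->
  (forall j, (j <= p j)%N) ->
  forall j, agree (p j) (y j) (fun i => y i.+1 i).
Proof.
move=> yS pS jp j.
have yt t : agree (p j) (y j) (y (j + t)%N).
  elim: t => [|t IH]; first by rewrite addn0.
  apply: agree_trans IH _; rewrite addnS; apply: agreeW (yS _).
  by elim: t => [|t IH]; rewrite ?addn0 // addnS (leq_trans IH).
have py t i : (i < p t)%N -> forall s, y (t + s)%N i = y t i.
  move=> it; elim=> [|s IH]; first by rewrite addn0.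
  rewrite addnS -IH; apply/esym/yS/(leq_trans it).
  by elim: s {IH} => [|s IH]; rewrite ?addn0 // addnS (leq_trans IH).
move=> i ij.
have e1 := py _ _ ij i.+1.
have e2 : (i < p i.+1)%N by exact: jp.
by rewrite -e1 addnC (py _ _ e2).
Qed.

(** Baire's theorem: the fusion of approximations that enter one more dense open
set at each stage meets all of them. *)
Lemma comeager_dense C : comeager C -> prefix_dense C.
Proof.
move=> [W Ood OC] x n.
pose P j (t t' : X * nat) := [/\ agree t.2 t.1 t'.1, (t.2 < t'.2)%N &
  forall y, agree t'.2 t'.1 y -> W j y].
have [|s s0 sP] := @dependent_sequence _ (x, n) P.
  move=> j [y p] /=; have [y' yy' Oy'] := (Ood j).2 y p.
  have [q hq] := (Ood j).1 _ Oy'.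
  exists (y', maxn p.+1 q); split => //=; first exact: leq_maxl.
  by move=> z h; apply/hq/(agreeW _ h)/leq_maxr.
have jp j : (j <= (s j).2)%N.
  by elim: j => // j IH; have [_ h _] := sP j; exact: leq_ltn_trans IH h.
have lim := @agree_limit (fun j => (s j).1) (fun j => (s j).2)
  (fun j => let: And3 h _ _ := sP j in h)
  (fun j => let: And3 _ h _ := sP j in ltnW h) jp.
exists (fun i => (s i.+1).1 i).
  by have := lim 0%N; rewrite s0.
apply: OC => l; have [_ _ h] := sP l; exact/h/(lim l.+1).
Qed.

Lemma comeagerW C C' : (forall x, C x -> C' x) -> comeager C -> comeager C'.
Proof. by move=> h [W Ood OC]; exists W => // x /OC/h. Qed.

Lemma comeager_forall (I : countType) (C : I -> set X) :
  (forall i, comeager (C i)) -> comeager [set x | forall i, C i x].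
Proof.
move=> C_co.
have /choice[W hW] : forall i, exists W : nat -> set X,
    (forall l, prefix_open (W l) /\ prefix_dense (W l)) /\
    (forall x, (forall l, W l x) -> C i x).
  by move=> i; have [W ? ?] := C_co i; exists W.
exists (fun n => if unpickle n is Some (i, l) then W i l else setT) =>
  [n|x Wx i].
  case: unpickle => [[i l]|]; first exact: (hW i).1.
  by split=> [x _|x p]; [exists 0%N|exists x].
by apply: (hW i).2 => l; have := Wx (pickle (i, l)); rewrite pickleK.
Qed.

Lemma comeagerI C C' : comeager C -> comeager C' ->
  comeager [set x | C x /\ C' x].
Proof.
move=> hC hC'; pose D b := if b then C else C'.
apply: comeagerW (_ : comeager [set x | forall b, D b x]).
  by move=> x h; split; [exact: (h true)|exact: (h false)].
by apply: comeager_forall => -[].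
Qed.

Lemma comeagerT : comeager setT.
Proof.
by exists (fun=> setT) => // _; split=> [x _|x p]; [exists 0%N|exists x].
Qed.

Lemma comeager_preimage (f g : X -> X) C :
  (forall n x y, agree n x y -> agree n (f x) (f y)) ->
  (forall n x y, agree n x y -> agree n (g x) (g y)) ->
  cancel f g -> cancel g f -> comeager C -> comeager [set x | C (f x)].
Proof.
move=> fA gA fK gK [W Wod WC].
exists (fun l => [set x | W l (f x)]) => [l|x Wx]; last exact: WC.
split=> [x Wx|x n].
  by have [n hn] := (Wod l).1 _ Wx; exists n => y /fA/hn.
have [y fxy Wy] := (Wod l).2 (f x) n.
by exists (g y); [rewrite -[x]fK; exact: gA|rewrite /= gK].
Qed.

(** A point at which [U] is decided lies off the boundary of [U].  Genericity is
only ever used in this form: if points of [U] accumulate at such a point, then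
the point is in [U]. *)
Definition decided U := [set x | U x \/ exterior U x].

Lemma comeager_decided U : prefix_open U -> comeager (decided U).
Proof.
move=> oU; exists (fun=> decided U) => [_|x /(_ 0%N)//]; split.
  move=> x [/oU|/exterior_open] [n h]; exists n => y /h; by [left|right].
move=> x n; have [[y xy Uy]|h] := pselect (exists2 y, agree n x y & U y).
  by exists y => //; left.
exists x => //; right; exists n => y xy Uy; apply: h; by exists y.
Qed.

(** The open set differs from [A] by a meager set. *)
Definition Baire_property A :=
  exists2 U, prefix_open U & comeager [set x | A x <-> U x].

Lemma Baire_property_open U : prefix_open U -> Baire_property U.
Proof. by move=> oU; exists U => //; apply: comeagerW comeagerT. Qed.

(** The one case that is not formal is the complement, where the exterior of the
open set serves because boundaries of open sets are nowhere dense. *)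
Lemma Baire_property_sigma : sigma_algebra setT Baire_property.
Proof.
split.
- by apply: Baire_property_open.
- move=> A [U oU hU]; exists (exterior U); first exact: exterior_open.
  apply: comeagerW (comeagerI hU (comeager_decided oU)) => x /= [AU dU].
  split=> [[_ nA]|eU]; first by case: dU => // /AU.
  by split=> // /AU Ux; have [n /(_ x)] := eU; apply.
- move=> F BF.
  have /choice[U hU] : forall n, exists U, prefix_open U /\
      comeager [set x | F n x <-> U x].
    by move=> n; have [U ? ?] := BF n; exists U.
  exists (\bigcup_n U n).
    move=> x [n _ Ux]; have [p hp] := (hU n).1 _ Ux.
    by exists p => y /hp Uy; exists n.
  apply: comeagerW (_ : comeager [set x | forall n, F n x <-> U n x]).
    by move=> x hx; split=> -[n _ /hx]; exists n.
  by apply: comeager_forall => n; exact: (hU n).2.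
Qed.

End PrefixTopology.

(** * Bi-invariant metrics *)

Section Auxiliary.

Variable R : realType.

(** A countable supply of tolerances tending to [0], so that quantifying over
tolerances keeps families of open sets countable. *)
Definition invS (n : nat) : R := n.+1%:R^-1.

Lemma invS_gt0 n : 0 < invS n.
Proof. by rewrite invr_gt0 ltr0n. Qed.

Lemma invS_le m n : (m <= n)%N -> invS n <= invS m.
Proof. by move=> mn; rewrite lef_pV2 ?posrE ?ltr0n // ler_nat. Qed.

Lemma invS_ltS n : invS n.+1 < invS n.
Proof. by rewrite ltf_pV2 ?posrE ?ltr0n // ltr_nat. Qed.

Lemma invS_lt (e : R) : 0 < e -> exists n : nat, invS n < e.
Proof.
move=> e0; exists (Num.truncn e^-1).
rewrite invf_plt ?posrE ?ltr0n //.
exact: truncnS_gt.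
Qed.

(** A choice among finitely many candidates that can be made for each [t] can be
made uniformly when larger [t] are more demanding. *)
Lemma monotone_pigeonhole (I : finType) (P : nat -> I -> Prop) :
  (forall t, exists i, P t i) ->
  (forall t t' i, (t <= t')%N -> P t' i -> P t i) ->
  exists i, forall t, P t i.
Proof.
move=> Pex Pmono; apply: contrapT => /forallNP nP.
have /choice[t ht] : forall i, exists t, ~ P t i.
  by move=> i; have /existsNP := nP i.
have [i Pi] := Pex (\max_i t i).
by apply: (ht i); apply: Pmono Pi; exact: leq_bigmax.
Qed.

End Auxiliary.

Section BiinvariantMetric.
Variables (R : realType) (G : groupType) (d : G -> G -> R).
Implicit Types a b c : G.

Record biinvariant_metric : Prop := {
  dist_xx : forall a, d a a = 0;
  dist_sym : forall a b, d a b = d b a;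
  dist_triangle : forall b a c, d a c <= d a b + d b c;
  dist_mull : forall c a b, d (c * a)%g (c * b)%g = d a b;
  dist_mulr : forall c a b, d (a * c)%g (b * c)%g = d a b }.

Hypothesis dP : biinvariant_metric.

Lemma dist_mul a b a' b' : d (a * b)%g (a' * b')%g <= d a a' + d b b'.
Proof. by rewrite (le_trans (dist_triangle dP (a' *
  b)%g _ _)) // (dist_mulr dP) (dist_mull dP). Qed.

Lemma dist_inv a b : d a^-1%g b^-1%g = d a b.
Proof. by rewrite -(dist_mull dP a) mulgV -(dist_mulr dP b) mul1g mulgVK
  (dist_sym dP). Qed.

Lemma dist_div a b a' b' : d (a / b)%g (a' / b')%g <= d a a' + d b b'.
Proof. by rewrite -(dist_inv b) dist_mul. Qed.

Lemma dist_div1 a b : d (a / b)%g 1%g = d a b.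
Proof. by rewrite -(dist_mulr dP b) mulgVK mul1g. Qed.

End BiinvariantMetric.

(** * The obstruction to a reduction *)

(** [theta] sends sequences of the group [S] to sequences of a group [G] with a
bi-invariant metric [d]. *)
Section Obstruction.
Variables (R : realType) (S G : groupType) (d : G -> G -> R).
Hypothesis dP : biinvariant_metric d.
Local Notation X := (nat -> S).
Variable theta : X -> nat -> G.
Implicit Types (x y z f g : X) (e eta : R).

Local Notation inv := (invS R).
Local Notation inv0 := (invS_gt0 R).

Definition seq_mul f x : X := fun n => (f n * x n)%g.
Definition seq_one : X := fun=> 1%g.

Lemma seq_mulA f g x : seq_mul f (seq_mul g x) = seq_mul (seq_mul f g) x.
Proof. by apply/funext => i; rewrite /seq_mul mulgA. Qed.

Lemma seq_mul1 x : seq_mul seq_one x = x.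
Proof. by apply/funext => i; rewrite /seq_mul mul1g. Qed.

Lemma seq_mul_agree f n x y : agree n x y ->
    agree n (seq_mul f x) (seq_mul f y).
Proof. by move=> h i /h e; rewrite /seq_mul e. Qed.

Lemma comeager_seq_mul f C : comeager C -> comeager [set x | C (seq_mul f x)].
Proof.
apply: (@comeager_preimage _ _ (seq_mul (fun n => (f n)^-1)%g)).
- exact: seq_mul_agree.
- exact: seq_mul_agree.
- by move=> x; apply/funext => i; rewrite /seq_mul mulKg.
- by move=> x; apply/funext => i; rewrite /seq_mul mulVKg.
Qed.

(** For the relation [E], the sequences [theta y] and [theta x] are compared
through these quotients. *)
Definition ratio m y x := (theta y m / theta x m)%g.

Lemma ratio_trans m y z x : ratio m z x = (ratio m z y * ratio m y x)%g.
Proof. by rewrite /ratio mulgA mulgVK. Qed.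

Lemma ratio_sym m y x : ratio m x y = (ratio m y x)^-1%g.
Proof. by rewrite /ratio invgF. Qed.

Lemma ratio_mul m y x : theta y m = (ratio m y x * theta x m)%g.
Proof. by rewrite /ratio mulgVK. Qed.

Lemma dist_ratio1 m y x : d (ratio m y x) 1%g = d (theta y m) (theta x m).
Proof. by rewrite dist_div1. Qed.

(** In a complete [G] this says that [theta y] and [theta x] are [E]-related. *)
Definition Cauchy_pair y x := forall e, 0 < e ->
  exists K, forall m m', (K <= m)%N -> (K <= m')%N ->
    d (ratio m y x) (ratio m' y x) < e.

(** [Delta] is a countable set of sequences, closed under products, which act on
[nat -> S] by left multiplication. *)
Variable enum_Delta : nat -> X.
Definition Delta : set X := range enum_Delta.
Hypothesis Delta1 : Delta seq_one.
Hypothesis DeltaM : forall f g, Delta f -> Delta g -> Delta (seq_mul f g).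

Variable c_ : nat -> G.
Hypothesis c_dense : forall (c : G) (e : R), 0 < e -> exists l, d c (c_ l) < e.
Hypothesis theta_Baire : forall m c e, 0 < e ->
  Baire_property [set x | d (theta x m) c < e].

(** As [G] is separable, countably many sets with the Baire property control
[theta], so [theta] is continuous on a comeager set; intersecting its translates
makes it invariant under the countable [Delta]. *)
Lemma continuity_points : exists2 W : nat -> set X,
  forall l, prefix_open (W l) /\ prefix_dense (W l) &
  let D := [set y | forall l, W l y] in
  (forall f y, Delta f -> D y -> D (seq_mul f y)) /\
  forall y m e, D y -> 0 < e -> exists n, forall z, D z -> agree n y z ->
    d (theta z m) (theta y m) < e.
Proof.
have /choice[U hU] : forall t : nat * nat * nat, exists U, prefix_open U /\
    comeager [set x | d (theta x t.1.1) (c_ t.1.2) < inv t.2 <-> U x].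
  by move=> t; have [U ? ?] := theta_Baire t.1.1 (c_ t.1.2) (inv0 t.2);
    exists U.
pose C := [set x | forall t : nat * nat * nat,
  d (theta x t.1.1) (c_ t.1.2) < inv t.2 <-> U t x].
have [W Wod WC] : comeager [set x | forall a, C (seq_mul (enum_Delta a) x)].
  apply: comeager_forall => a; apply: comeager_seq_mul.
  by apply: comeager_forall => t; exact: (hU t).2.
pose W' n := if unpickle n is Some (a,
  l) then [set y | W l (seq_mul (enum_Delta a) y)]
  else setT.
have W'od l : prefix_open (W' l) /\ prefix_dense (W' l).
  rewrite /W'; case: unpickle => [[a l']|]; last first.
    by split=> [x _|x p]; [exists 0%N|exists x].
  have [Wo Wd] := Wod l'; split=> [x /Wo[n hn]|x n].
    by exists n => y xy; apply/hn/seq_mul_agree.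
  have [y xy Wy] := Wd (seq_mul (enum_Delta a) x) n.
  exists (seq_mul (fun n => (enum_Delta a n)^-1)%g y).
    by move=> i ni; rewrite /seq_mul -xy // /seq_mul mulKg.
  by rewrite /seq_mul /=; under eq_fun do rewrite mulVKg.
exists W' => // D.
have DW y : D y -> forall a l, W l (seq_mul (enum_Delta a) y).
  by move=> Dy a l; have := Dy (pickle (a, l)); rewrite /W' pickleK.
split=> [f y [a _ <-] Dy l|y m e Dy e0].
  rewrite /W'; case: unpickle => // -[b l'] /=; rewrite seq_mulA.
  have [c _ <-] : Delta (seq_mul (enum_Delta b) (enum_Delta a)).
    by apply: DeltaM; [exists b|exists a].
  exact: DW.
have DC z : D z -> C z.
  move=> Dz; have [a _ ea] := Delta1; rewrite -[z]seq_mul1 -ea.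
  by apply: WC => l; have := DW _ Dz a l; rewrite ea seq_mul1.
have e2 : 0 < e / 2 by lra.
have [p hp] := invS_lt e2.
have [l hl] := c_dense (theta y m) (inv0 p).
have /(_ (m, l, p))/= [Uy _] := DC _ Dy.
have [n hn] := (hU (m, l, p)).1 _ (Uy hl).
exists n => z Dz /hn Uz; have /(_ (m, l, p))/= [_ /(_ Uz) zl] := DC _ Dz.
rewrite (le_lt_trans (dist_triangle dP (c_ l) _ _)) // (dist_sym dP (c_ l)).
by lra.
Qed.

(** [T] embeds a group of vectors into [S] as translations, and conjugation by
[r i] turns the vector [step_vec N 0] into [step_vec N i]. *)
Variables (V : zmodType) (T : V -> S) (k : nat) (step_vec : nat -> nat ->
    V) (r : nat -> S).
Hypothesis T_add : forall v w, T (v + w) = (T v * T w)%g.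
Hypothesis r_T : forall i N, (r i * T (step_vec N 0))%g = (T (step_vec N i) *
    r i)%g.
Implicit Types (h : nat -> V) (v w : V).

Let T0 : T 0 = 1%g.
Proof. by apply: (mulgI (T 0)); rewrite -T_add addr0 mulg1. Qed.

Definition translate h x := seq_mul (fun n => T (h n)) x.
Definition step n v : nat -> V := fun i => if (n <= i)%N then v else 0.
Definition rotate_from j i : X := fun n => if (j <= n)%N then r i else 1%g.
Definition unrotate_from j i : X := fun n => if (j <=
    n)%N then (r i)^-1%g else 1%g.
Definition Delta_shift h := Delta (fun n => T (h n)).

Hypothesis Delta_step : forall n N i, Delta_shift (step n (step_vec N i)).
Hypothesis Delta_stepN : forall n N i, Delta_shift (step n (- step_vec N i)).
Hypothesis Delta_rotate : forall j i, Delta (rotate_from j i).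
Hypothesis Delta_unrotate : forall j i, Delta (unrotate_from j i).

Lemma Delta_shift0 : Delta_shift 0.
Proof. by rewrite /Delta_shift /=; have -> : (fun n => T ((0 : nat -> V) n)) =
  seq_one by apply/funext. Qed.

Lemma Delta_shift_add h h' : Delta_shift h -> Delta_shift h' ->
    Delta_shift (h + h').
Proof.
rewrite /Delta_shift => Dh Dh'; have -> : (fun n => T ((h + h') n)) =
  seq_mul (fun n => T (h n)) (fun n => T (h' n)) by apply/funext => n;
    exact: T_add.
exact: DeltaM.
Qed.

Lemma translate_add h h' x : translate (h + h') x =
    translate h (translate h' x).
Proof. by apply/funext => n; rewrite /translate /seq_mul mulgA -T_add. Qed.

Lemma translate0 x : translate 0 x = x.
Proof. by apply/funext => n; rewrite /translate /seq_mul T0 mul1g. Qed.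

Lemma translateC h h' x : translate h (translate h' x) =
    translate h' (translate h x).
Proof. by rewrite -!translate_add addrC. Qed.

Lemma translate_agree h n x : (forall i, (i < n)%N -> h i = 0) ->
    agree n x (translate h x).
Proof. by move=> h0 i /h0 e; rewrite /translate /seq_mul e T0 mul1g. Qed.

Lemma agree_step n m v x : (m <= n)%N -> agree m x (translate (step n v) x).
Proof.
by move=> mn; apply: translate_agree => i im;
  rewrite /step leqNgt (leq_trans im).
Qed.

Hypothesis Delta_Cauchy : forall f x, Delta f -> Cauchy_pair (seq_mul f x) x.
Hypothesis c_bounded : forall (e : R), 0 < e -> exists L, forall g : G,
  d g 1%g < 1 -> exists2 l, (l < L)%N & d g (c_ l) < e.
(** Conjugation acts in at most [k] ways on the elements near [1]. *)
Hypothesis conj_pigeonhole : forall c, d c 1%g < 1 -> forall g : nat -> G,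
  exists i i', [/\ (i < i')%N, (i' <= k)%N &
    (g i * c / g i = g i' * c / g i')%g].
Hypothesis step_vec_double : forall N i, step_vec N i *+ 2 ^ N = step_vec 0 i.
(** Steps by vectors [step_vec N i] with [N] tending to infinity add up to
a convergent sequence, however late they start. *)
Hypothesis sum_Cauchy : forall (p : nat -> nat) (v : nat -> V) x,
  (forall j, exists N i, [/\ (j <= N)%N, (i <= k)%N & v j = step_vec N i]) ->
  (forall j, (j <= p j)%N) ->
  Cauchy_pair (translate (fun n => \sum_(j < n.+1 | (p j <= n)%N) v j) x) x.
Hypothesis unbounded_not_Cauchy : forall i i' (f : nat -> V) x,
  (i < i')%N -> (i' <= k)%N ->
  (forall t, exists n, f n = (step_vec 0 i' - step_vec 0 i) *+ t) ->
    ~ Cauchy_pair (translate f x) x.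

(** [D] consists of continuity points of [theta], and [x] is a generic point of
[D]. *)
Section GenericPoint.
Variable W : nat -> set X.
Let D := [set y | forall l, W l y].
Hypothesis W_open : forall l, prefix_open (W l).
Hypothesis D_Delta : forall f y, Delta f -> D y -> D (seq_mul f y).
Hypothesis theta_continuous : forall y m e, D y -> 0 < e ->
  exists n, forall z, D z -> agree n y z -> d (theta z m) (theta y m) < e.

Lemma theta_continuous_upto y K e : D y -> 0 < e ->
  exists n, forall z, D z -> agree n y z ->
    forall m, (m <= K)%N -> d (theta z m) (theta y m) < e.
Proof.
move=> Dy e0; elim: K => [|K [n hn]].
  have [n hn] := theta_continuous 0 Dy e0.
  by exists n => z Dz /hn h m; rewrite leqn0 => /eqP->; exact: h.
have [n' hn'] := theta_continuous K.+1 Dy e0.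
exists (maxn n n') => z Dz yz m; rewrite leq_eqVlt => /predU1P[->|].
  by apply/hn' => //; apply: agreeW yz; exact: leq_maxr.
by rewrite ltnS; apply: hn => //; apply: agreeW yz; exact: leq_maxl.
Qed.

Definition rel_interior (P : X -> Prop) :=
  [set y | exists q, forall z, D z -> agree q y z -> P z].

Lemma rel_interior_open P : prefix_open (rel_interior P).
Proof.
move=> y [q hq]; exists q => z yz; exists q => t Dt zt.
by apply: hq => //; exact: agree_trans yz zt.
Qed.

Lemma rel_interior_sub P y : D y -> rel_interior P y -> P y.
Proof. by move=> Dy [q /(_ y Dy)]; apply. Qed.

Definition spread (f : X) (e : R) (N : nat) (z : X) :=
  exists m m', [/\ (N <= m)%N, (N <= m')%N &
    e < d (ratio m (seq_mul f z) z) (ratio m' (seq_mul f z) z)].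

(** Strict inequalities between values of [theta] persist near a continuity
point. *)
Lemma spread_open f e N y : Delta f -> D y -> spread f e N y ->
  rel_interior (spread f e N) y.
Proof.
move=> Df Dy [m [m' [Nm Nm' hy]]].
set e' := (d (ratio m (seq_mul f y) y) (ratio m' (seq_mul f y) y) - e) / 4.
have e'0 : 0 < e' by rewrite /e'; lra.
have [n1 h1] := theta_continuous_upto (maxn m m') Dy e'0.
have [n2 h2] := theta_continuous_upto (maxn m m') (D_Delta Df Dy) e'0.
exists (maxn n1 n2) => z Dz yz; exists m, m'; split=> //.
have yz1 : agree n1 y z by apply: agreeW yz; exact: leq_maxl.
have yz2 : agree n2 (seq_mul f y) (seq_mul f z).
  by apply/seq_mul_agree/(agreeW _ yz); exact: leq_maxr.
have a1 := h1 z Dz yz1 m (leq_maxl _ _).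
have a2 := h1 z Dz yz1 m' (leq_maxr _ _).
have a3 := h2 _ (D_Delta Df Dz) yz2 m (leq_maxl _ _).
have a4 := h2 _ (D_Delta Df Dz) yz2 m' (leq_maxr _ _).
have := dist_triangle dP (ratio m (seq_mul f z) z) (ratio m (seq_mul f y) y)
  (ratio m' (seq_mul f y) y).
have := dist_triangle dP (ratio m' (seq_mul f z) z) (ratio m (seq_mul f z) z)
  (ratio m' (seq_mul f y) y).
have := dist_div dP (theta (seq_mul f y) m) (theta y m) (theta (seq_mul f z) m)
  (theta z m).
have := dist_div dP (theta (seq_mul f z) m') (theta z m') (theta (seq_mul f y)
  m') (theta y m').
rewrite -!/(ratio _ _ _) (dist_sym dP (theta (seq_mul f y) m)) (dist_sym dP
  (theta y m)).
by rewrite /e' in a1 a2 a3 a4 *; lra.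
Qed.

(** The sets of points where the quotients have settled after [N] cover [D] and
are closed in [D], so a point off all their boundaries is interior to one of
them.  Near such a point the quotients settle uniformly, hence vary continuously
uniformly in [m]. *)
Lemma uniform_Cauchy f y : Delta f -> D y ->
  (forall p N, decided (rel_interior (spread f (inv p) N)) y) ->
  forall e, 0 < e -> exists n, forall z, D z -> agree n y z ->
    forall m, d (ratio m (seq_mul f z) z) (ratio m (seq_mul f y) y) < e.
Proof.
move=> Df Dy dec e e0; have e4 : 0 < e / 4 by lra.
have [p hp] := invS_lt e4.
have [K hK] := Delta_Cauchy y Df (inv0 p).
have [|[n hn]] := dec p K.
  move=> /(rel_interior_sub Dy)[m [m' [Km Km']]].
  by rewrite ltNge (ltW (hK _ _ Km Km')).
have hz z : D z -> agree n y z -> forall m m', (K <= m)%N -> (K <= m')%N ->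
    d (ratio m (seq_mul f z) z) (ratio m' (seq_mul f z) z) <= inv p.
  move=> Dz yz m m' Km Km'; rewrite leNgt; apply/negP => h.
  by apply: (hn _ yz); apply: spread_open => //; exists m, m'.
have e8 : 0 < e / 8 by lra.
have [n1 h1] := theta_continuous_upto K Dy e8.
have [n2 h2] := theta_continuous_upto K (D_Delta Df Dy) e8.
exists (maxn n (maxn n1 n2)) => z Dz yz.
have yz0 : agree n y z by apply: agreeW yz; exact: leq_maxl.
have yz1 : agree n1 y z.
  by apply: agreeW yz; rewrite leq_max leq_max leqnn orbT.
have yz2 : agree n2 (seq_mul f y) (seq_mul f z).
  by apply/seq_mul_agree/(agreeW _ yz); rewrite leq_max leq_max leqnn !orbT.
have small m : (m <= K)%N -> d (ratio m (seq_mul f z) z) (ratio m (seq_mul f y)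
  y) < e / 4.
  move=> mK; rewrite (le_lt_trans (dist_div dP _ _ _ _)) //.
  have := h1 z Dz yz1 m mK; have := h2 _ (D_Delta Df Dz) yz2 m mK.
  by lra.
move=> m; have [mK|Km] := leqP m K; first by have := small m mK; lra.
have := dist_triangle dP (ratio K (seq_mul f z) z) (ratio m (seq_mul f z) z)
  (ratio m (seq_mul f y) y).
have := dist_triangle dP (ratio K (seq_mul f y) y) (ratio K (seq_mul f z) z)
  (ratio m (seq_mul f y) y).
have := hz z Dz yz0 m K (ltnW Km) (leqnn _).
have := hK K m (leqnn _) (ltnW Km).
have := small K (leqnn _).
by lra.
Qed.

Variable x : X.
Hypothesis Dx : D x.
Hypothesis spread_decided : forall a b p N,
  decided (rel_interior (spread (enum_Delta b) (inv p) N)) (seq_mul (enum_Delta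
    a) x).

Lemma uniform f g : Delta f -> Delta g -> forall e, 0 < e ->
  exists n, forall z, D z -> agree n (seq_mul f x) z ->
    forall m, d (ratio m (seq_mul g z) z) (ratio m (seq_mul g (seq_mul f x))
      (seq_mul f x)) < e.
Proof.
move=> [a _ <-] [b _ <-]; apply: uniform_Cauchy; [by exists b| |].
  by apply: D_Delta => //; exists a.
exact: spread_decided.
Qed.

Lemma D_translate h y : Delta_shift h -> D y -> D (translate h y).
Proof. exact: D_Delta. Qed.

Lemma uniform_translate h g : Delta_shift h -> Delta g -> forall e, 0 < e ->
  exists n, forall z, D z -> agree n (translate h x) z ->
    forall m, d (ratio m (seq_mul g z) z) (ratio m (seq_mul g (translate h x))
      (translate h x)) < e.
Proof. by move=> Dh Dg; exact: uniform. Qed.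

Lemma uniform1 g : Delta g -> forall e, 0 < e ->
  exists n, forall z, D z -> agree n x z ->
    forall m, d (ratio m (seq_mul g z) z) (ratio m (seq_mul g x) x) < e.
Proof. by move=> Dg e e0; have := uniform_translate Delta_shift0 Dg e0;
  rewrite translate0. Qed.

(** Translations commute, so that the bump of [f] at a translate of [x] differs
from the bump at [x] only through the variation of the quotients for [h]; the
bi-invariance of [d] removes the conjugation. *)
Lemma bump_conj h (f : nat -> V) m :
  `|d (theta (translate f (translate h x)) m) (theta (translate h x) m) -
    d (theta (translate f x) m) (theta x m)| <=
  d (ratio m (translate h (translate f x)) (translate f x)) (ratio m (translate
    h x) x).
Proof.
rewrite translateC (ratio_mul m (translate h (translate f x)) (translate f x))
  (ratio_mul m (translate h x) x).
set a := ratio m (translate h (translate f x)) _; set b :=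
  ratio m (translate h x) x.
have h1 := dist_mul dP a (theta (translate f x) m) b (theta x m).
have h2 := dist_triangle dP (b * theta x m)%g (a *
  theta (translate f x) m)%g (a * theta x m)%g.
rewrite (dist_mull dP) (dist_mulr dP) (dist_sym dP b) in h2.
by rewrite ler_norml; apply/andP; split; lra.
Qed.

(** What late steps do at [x] they do, up to [e], at each translate of [x]. *)
Lemma bump_transport h e : Delta_shift h -> 0 < e -> exists n,
    forall f : nat -> V, Delta_shift f ->
  agree n x (translate f x) -> forall m,
  `|d (theta (translate f (translate h x)) m) (theta (translate h x) m) -
    d (theta (translate f x) m) (theta x m)| < e.
Proof.
move=> Dh e0; have [n hn] := uniform1 Dh e0.
exists n => f Df xf m; apply: le_lt_trans (bump_conj _ _ _) _.
by apply: hn => //; exact: D_translate.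
Qed.

(** If arbitrarily small steps had bumps of size [e], then by [bump_transport]
they would have bumps of size [e / 2] at every translate of [x].  Fusing such
steps, each starting after the effect of the previous ones has settled, gives a
convergent sequence of translations [g] for which the quotients of [theta (g x)]
by [theta x] oscillate by a fraction of [e] for ever. *)
Lemma small_steps e : 0 < e -> exists N0, forall N, (N0 <= N)%N ->
  exists M, forall i n m, (i <= k)%N -> (M <= n)%N ->
    d (theta (translate (step n (step_vec N i)) x) m) (theta x m) < e.
Proof.
move=> e0; apply: contrapT => /forallNP nA.
have bad N0 : exists2 N, (N0 <= N)%N & forall M, exists i n m,
    [/\ (i <= k)%N, (M <= n)%N &
     e <= d (theta (translate (step n (step_vec N i)) x) m) (theta x m)].
  have /existsNP[N /not_implyP[N0N /forallNP hN]] := nA N0.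
  exists N => // M; apply: contrapT => no; apply: (hN M) => i n m ik Mn.
  by rewrite ltNge; apply/negP => h; apply: no; exists i, n, m.
have e2 : 0 < e / 2 by lra.
have badh h : Delta_shift h -> forall N0 M K, exists N i n m,
    [/\ (N0 <= N)%N, (i <= k)%N, (M <= n)%N, (K <= m)%N &
     e / 2 < d (theta (translate (step n (step_vec N i)) (translate h x)) m)
       (theta (translate h x) m)].
  move=> Dh N0 M K; have [N N0N hN] := bad N0.
  have [n1 h1] := bump_transport Dh e2.
  have [n2 h2] := theta_continuous_upto K Dx e0.
  have [i [n [m [ik]]]] := hN (maxn M (maxn n1 n2)).
  rewrite !geq_max => /and3P[Mn n1n n2n] he.
  exists N, i, n, m; split=> //.
    rewrite leqNgt; apply/negP => /ltnW mK.
    have := h2 _ (D_translate (Delta_step n N i) Dx) (agree_step _ _ n2n) m mK.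
    by rewrite ltNge he.
  have := h1 _ (Delta_step n N i) (agree_step _ _ n1n) m.
  by rewrite ltr_norml => /andP[]; lra.
(* Four errors of this size are subtracted from a bump of size [e / 2]. *)
have e16 : 0 < e / 16 by lra.
(* state: shift, start of the last step, protected coordinate, last vector *)
pose St := ((nat -> V) * nat * nat * V)%type.
(* [n'] is beyond the indices that control the quotients up to [mu] and [K], so
   later steps no longer change them; [K] is an index at which the effect of [h]
   has settled, and [mu'] one at which the bump of the new step is seen. *)
pose P j (t t' : St) := let: (h, n, mu, _) := t in
  let: (h', n', mu', v') := t' in
  Delta_shift h -> exists K, [/\
    [/\ Delta_shift h', h' = step n' v' + h,
        exists N i, [/\ (j <= N)%N, (i <= k)%N & v' = step_vec N i], (j <=
          n')%N &
        (n <= n')%N],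
    [/\ (j <= K)%N, (K <= mu')%N &
        forall m m', (K <= m)%N -> (K <= m')%N ->
          d (ratio m (translate h x) x) (ratio m' (translate h x) x) < e / 16],
    forall z, agree n' (translate h x) z -> W j z,
    forall z, D z -> agree n' (translate h x) z -> forall m, (m <=
      maxn mu K)%N ->
      d (theta z m) (theta (translate h x) m) < e / 16 &
    e / 2 < d (theta (translate h' x) mu') (theta (translate h x) mu')].
have [j t|s s0 sP] := @dependent_sequence _ ((0, 0%N, 0%N, 0) : St) P.
  case: t => [[[h n] mu] v0].
  have [Dh|nDh] := pselect (Delta_shift h); last by exists (h, n, mu, v0) =>
    /nDh.
  have [K0 hK0] := Delta_Cauchy x Dh e16.
  set K := maxn j K0.
  have [n1 h1] := theta_continuous_upto (maxn mu K) (D_translate Dh Dx) e16.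
  have [n2 h2] := W_open (D_translate Dh Dx j).
  have [N [i [n' [m [jN ik nn' Km he]]]]] :=
    badh h Dh j (maxn (maxn j n) (maxn n1 n2)) K.
  move: nn'; rewrite !geq_max => /andP[/andP[jn' nn'] /andP[n1n' n2n']].
  exists (step n' (step_vec N i) + h, n', m, step_vec N i) => _; exists K;
    split.
  - split=> //; last by exists N, i.
    by apply: Delta_shift_add.
  - split=> //; first exact: leq_maxl.
    by move=> m1 m2 K1 K2; apply: hK0;
      [apply: leq_trans K1|apply: leq_trans K2];
      exact: leq_maxr.
  - by move=> z hz; exact/h2/(agreeW n2n').
  - by move=> z Dz hz; exact/h1/(agreeW n1n').
  - by rewrite translate_add.
pose hh j := (s j).1.1.1; pose p j := (s j.+1).1.1.2.
pose mu j := (s j).1.2; pose v j := (s j.+1).2.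
have Dhh j : Delta_shift (hh j).
  elim: j => [|j]; first by rewrite /hh s0; exact: Delta_shift0.
  rewrite /hh; have := sP j; case: (s j) => [[[h n] m] w] /=.
  by case: (s j.+1) => [[[h' n'] m'] w'] /= /[apply] -[K [[]]].
have {sP} sP j : exists K, [/\
    [/\ hh j.+1 = step (p j) (v j) + hh j,
        exists N i, [/\ (j <= N)%N, (i <= k)%N & v j = step_vec N i], (j <=
          p j)%N &
        (p j <= p j.+1)%N],
    [/\ (j <= K)%N, (K <= mu j.+1)%N &
        forall m m', (K <= m)%N -> (K <= m')%N ->
          d (ratio m (translate (hh j) x) x) (ratio m' (translate (hh j) x) x)
            < e / 16],
    forall z, agree (p j) (translate (hh j) x) z -> W j z,
    forall z, D z -> agree (p j) (translate (hh j) x) z -> forall m, (m <=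
      maxn (mu j) K)%N ->
      d (theta z m) (theta (translate (hh j) x) m) < e / 16 &
    e / 2 < d (theta (translate (hh j.+1) x) (mu j.+1)) (theta (translate (hh
      j) x) (mu j.+1))].
  have pp : (p j <= p j.+1)%N.
    have := sP j.+1; have := Dhh j.+1; rewrite /hh /p.
    case: (s j.+1) => [[[h n] m] w] /=.
    by case: (s j.+2) => [[[h' n'] m'] w'] /= Dh /(_ Dh) [K [[]]].
  have := sP j; have := Dhh j; move: pp; rewrite /hh /p /mu /v.
  case: (s j) => [[[h n] m] w] /=; case: (s j.+1) => [[[h' n'] m'] w'] /=.
  by move=> pp Dh /(_ Dh) [K [[? ? ? ? ?] ? ? ? ?]]; exists K; split.
have jp j : (j <= p j)%N by have [K [[]]] := sP j.
have hh_sum j i : hh j i = \sum_(l < j | (p l <= i)%N) v l.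
  elim: j => [|j IH]; first by rewrite /hh s0 big_ord0.
  have [K [[-> _ _ _] _ _ _ _]] := sP j.
  rewrite big_mkcond big_ord_recr /= -big_mkcond /= -IH addrC.
  by rewrite /step.
pose g n := \sum_(j < n.+1 | (p j <= n)%N) v j.
have lim j : agree (p j) (translate (hh j) x) (translate g x).
  have := @agree_limit _ (fun j => translate (hh j) x) p; move/(_ _ _ jp).
  have -> : (fun i : nat => translate (hh i.+1) x i) = translate g x.
    by apply/funext => i; rewrite /translate /seq_mul hh_sum.
  apply=> // l; last by have [K [[]]] := sP l.
  by have [K [[-> _ _ _] _ _ _ _]] := sP l; rewrite translate_add;
    exact: agree_step.
have Dg : D (translate g x) by move=> l; have [K [_ _ h _ _]] := sP l;
  exact/h/lim.
have [|J hJ] := @sum_Cauchy p v x _ jp _ e16.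
  by move=> j; have [K [[_ ? _ _] _ _ _ _]] := sP j.
have [K [_ [JK Kmu hK] _ hc he]] := sP J.
have [K' [_ _ _ hc' _]] := sP J.+1.
have a1 := hJ _ _ (leq_trans JK Kmu) JK.
have a2 := hc' _ Dg (lim J.+1) (mu J.+1) (leq_maxl _ _).
have a3 := hc _ Dg (lim J) K (leq_maxr _ _).
have a4 := hK _ _ Kmu (leqnn K).
rewrite -(dist_mulr dP (theta x (mu J.+1))^-1%g) -!/(ratio _ _ _) in a2.
rewrite -(dist_mulr dP (theta x K)^-1%g) -!/(ratio _ _ _) in a3.
rewrite -(dist_mulr dP (theta x (mu J.+1))^-1%g) -!/(ratio _ _ _) in he.
have := dist_triangle dP (ratio (mu J.+1) (translate g x) x) (ratio (mu J.+1)
  (translate (hh J.+1) x) x)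
  (ratio (mu J.+1) (translate (hh J) x) x).
have := dist_triangle dP (ratio K (translate g x) x) (ratio (mu J.+1)
  (translate g x) x)
  (ratio (mu J.+1) (translate (hh J) x) x).
have := dist_triangle dP (ratio K (translate (hh J) x) x) (ratio K (translate g
  x) x)
  (ratio (mu J.+1) (translate (hh J) x) x).
rewrite (dist_sym dP (ratio K (translate (hh J) x) x)).
rewrite (dist_sym dP (ratio (mu J.+1) (translate (hh J.+1) x) x) (ratio (mu
  J.+1) (translate g x) x)).
by rewrite -/g in a1; lra.
Qed.

(** The effect of the step [step_vec N 0] at [n] is within [e] of a conjugate of
[c].  Passing to conjugates makes the notion insensitive to the base point: see
[hits_rotated]. *)
Definition hits N n c (e : R) z := exists (g : G) K, forall m, (K <= m)%N ->
  d (ratio m (translate (step n (step_vec N 0)) z) z) (g * c / g)%g < e.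

(** The factor [3] leaves room for the mesh of the net, for the effect to settle
and for moving the base point. *)
Definition hit_set N l p M :=
  rel_interior (fun z => exists2 n, (M <= n)%N & hits N n (c_ l) (3 * inv p) z).

(** Steps by [step_vec N i'] and [- step_vec N i] whose joint bump is less than
[e] and whose joint effect is less than [eta]. *)
Definition paired N (e eta : R) M i i' z := exists n n', [/\ (M <= n)%N,
    (M <= n')%N,
  forall m, d (theta (translate (step n' (step_vec N i') +
    step n (- step_vec N i)) z) m)
    (theta z m) < e &
  exists K, forall m, (K <= m)%N ->
    d (theta (translate (step n' (step_vec N i') +
      step n (- step_vec N i)) z) m) (theta z m) < eta].

(** The constant [13] is twice the error [6] of [hits_rotated], plus [1] for
moving the base point; likewise [3] is twice the bump of one step plus [1]. *)
Definition pair_set N q p M := rel_interior (fun z => exists i i',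
  [/\ (i < i')%N, (i' <= k)%N & paired N (3 * inv q) (13 * inv p) M i i' z]).

Hypothesis hit_decided : forall j i N l p M,
  decided (hit_set N l p M) (seq_mul (unrotate_from j i) x).
Hypothesis hit_limit_decided : forall N l p,
  decided (exterior [set z | forall M, hit_set N l p M z]) x.
Hypothesis pair_decided : forall N q p M, decided (pair_set N q p M) x.

(** A late step by [step_vec N i] is a rotated step by [step_vec N 0]. *)
Lemma step_rotated n j i N z : (j <= n)%N ->
  seq_mul (rotate_from j i) (translate (step n (step_vec N 0)) (seq_mul
    (unrotate_from j i) z)) =
  translate (step n (step_vec N i)) z.
Proof.
move=> jn; apply/funext => a; rewrite /translate /seq_mul /step /rotate_from
  /unrotate_from.
case: (leqP j a) => ja; case: (leqP n a) => na.
- by rewrite mulgA r_T -!mulgA mulVKg.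
- by rewrite T0 !mul1g mulVKg.
- by have := leq_ltn_trans (leq_trans jn na) ja; rewrite ltnn.
- by rewrite T0 !mul1g.
Qed.

Lemma unrotate_fromK j i z : seq_mul (rotate_from j i) (seq_mul (unrotate_from
    j i) z) = z.
Proof.
by apply/funext => a; rewrite /seq_mul /rotate_from /unrotate_from;
  case: leqP => _;
  rewrite ?mulVKg ?mul1g.
Qed.

Lemma agree_unrotate_from j i z : agree j z (seq_mul (unrotate_from j i) z).
Proof. by move=> a aj; rewrite /seq_mul /unrotate_from leqNgt aj mul1g. Qed.

Section Pairs.
Variables (N q p M0 : nat).
Hypothesis q_small : inv q <= 1 / 2.
Hypothesis p_small : inv p < 1 / 4.
Hypothesis small : forall i n m, (i <= k)%N -> (M0 <= n)%N ->
  d (theta (translate (step n (step_vec N i)) x) m) (theta x m) < inv q.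

(** The effects of late steps lie in a totally bounded ball, so one of finitely
many centres [c_ l] is approached infinitely often. *)
Lemma hits_at_x : exists2 l, d (c_ l) 1%g < 1 &
  forall M, exists2 n, (M <= n)%N & hits N n (c_ l) (2 * inv p) x.
Proof.
have [L hL] := c_bounded (inv0 p).
have hit M : exists l : 'I_L, d (c_ l) 1%g < 1 /\
    exists2 n, (M <= n)%N & hits N n (c_ l) (2 * inv p) x.
  set n := maxn M M0.
  have [K hK] := Delta_Cauchy x (Delta_step n N 0) (inv0 p).
  have sK : d (ratio K (translate (step n (step_vec N 0)) x) x) 1%g < inv q.
    by rewrite dist_ratio1; apply: small => //; exact: leq_maxr.
  have [|l lL hl] := hL (ratio K (translate (step n (step_vec N 0)) x) x).
    by have := q_small; lra.
  exists (Ordinal lL); split=> /=.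
    rewrite (le_lt_trans (dist_triangle dP (ratio K (translate (step n
      (step_vec N 0)) x) x) _ _)) //.
    by rewrite (dist_sym dP (c_ l)); have := q_small; have := p_small; lra.
  exists n; first exact: leq_maxl.
  exists 1%g, K => m Km; rewrite invg1 mulg1 mul1g.
  have := hK m K Km (leqnn _).
  have := dist_triangle dP (ratio K (translate (step n (step_vec N 0)) x) x)
    (ratio m (translate (step n (step_vec N 0)) x) x) (c_ l).
  by rewrite /translate in hl *; lra.
have [|l hl] := monotone_pigeonhole hit.
  by move=> M M' l MM' [? [n M'n ?]]; split=> //; exists n => //;
    exact: leq_trans M'n.
exists l; first by have [] := hl 0%N.
by move=> M; have [] := hl M.
Qed.

(** The set of sequences at which the effect of late steps approaches [c_ l]
infinitely often is a countable intersection of open sets, and [x] is in it.  As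
[x] is off the boundary of its closure, it is dense near [x]; and the translates
of [x] that are near [x] are generic too, so they belong to it. *)
Lemma hits_everywhere : exists2 l, d (c_ l) 1%g < 1 &
  exists j, forall i M, exists2 n, (M <= n)%N &
    hits N n (c_ l) (3 * inv p) (seq_mul (unrotate_from j i) x).
Proof.
have [l l1 hl] := hits_at_x; exists l => //.
have inU M : hit_set N l p M x.
  have [n Mn [g [K hK]]] := hl M.
  have [a ha] := uniform1 (Delta_step n N 0) (inv0 p).
  exists a => z Dz xz; exists n => //; exists g, K => m Km.
  have := ha z Dz xz m; have := hK m Km.
  have := dist_triangle dP (ratio m (translate (step n (step_vec N 0)) x) x)
    (ratio m (translate (step n (step_vec N 0)) z) z) (g * c_ l / g)%g.
  by rewrite /translate; lra.
have [[a /(_ x)]|[j hj]] := hit_limit_decided N l p.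
  by case=> // M; exact: inU.
exists j => i M.
have Dz : D (seq_mul (unrotate_from j i) x) by exact: D_Delta.
have [|[a ha]] := hit_decided j i N l p M.
  exact: (rel_interior_sub Dz).
have [] := hj _ (@agree_unrotate_from j i x).
by exists a => y /ha nU /(_ M).
Qed.

(** The effect of a step by [step_vec N i] at [x] is conjugate to that of a step
by [step_vec N 0] at the rotated point; rotating only from a late index on keeps
that point near [x], where [hits_everywhere] applies. *)
Lemma hits_rotated : exists2 c, d c 1%g < 1 &
  forall i M, exists n (g : G) K, (M <= n)%N /\ forall m, (K <= m)%N ->
    d (ratio m (translate (step n (step_vec N i)) x) x) (g * c / g)%g < 6 *
      inv p.
Proof.
have [l l1 [j hj]] := hits_everywhere; exists (c_ l) => // i M.
set z := seq_mul (unrotate_from j i) x.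
have Dz : D z by exact: D_Delta.
have [a ha] := uniform (Delta_unrotate j i) (Delta_rotate j i) (inv0 p).
have [n] := hj i (maxn M (maxn j a)).
rewrite !geq_max => /and3P[Mn jn an] [g [K hK]].
have [K' hK'] := Delta_Cauchy z (Delta_rotate j i) (inv0 p).
rewrite unrotate_fromK in hK'; rewrite -/z unrotate_fromK in ha.
exists n, (ratio K' x z * g)%g, (maxn K K'); split=> // m.
rewrite geq_max => /andP[Km K'm].
set y := translate (step n (step_vec N 0)) z.
have Dy : D y by exact: D_translate.
have := ha y Dy (agree_step _ _ an) m.
rewrite /y step_rotated // -/y => h1.
rewrite (ratio_trans m y) (ratio_trans m z y) (ratio_sym m x z).
have h2 := hK m Km; rewrite -/z -/y in h2.
have h3 := hK' m K' K'm (leqnn _).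
set b := ratio m x z in h1 h3 *; set b' := ratio K' x z in h3 *.
set c := (g * c_ l / g)%g in h2.
have -> : (b' * g * c_ l / (b' * g) = b' * (c / b'))%g.
  by rewrite /c invgM !mulgA.
have := dist_mul dP (ratio m (translate (step n (step_vec N i)) x) y) (ratio m
  y z / b)%g b' (c / b')%g.
have := dist_div dP (ratio m y z) b c b'.
have := dist_triangle dP b (ratio m (translate (step n (step_vec N i)) x) y) b'.
by lra.
Qed.

(** Two of the [k + 1] conjugates of [c] coincide, so two of the rotated steps
have nearly equal effects.  Starting from the translate of [x] by the first of
these steps, undoing it and making the second has almost no effect. *)
Lemma pair_near M : exists i i' y, [/\ (i < i')%N, (i' <= k)%N, agree M x y,
  D y & exists h, [/\ Delta_shift h, y = translate h x &
  paired N (2 * inv q) (12 * inv p) M i i' y]].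
Proof.
have [c c1 hit] := hits_rotated.
have /choice[n] := fun i => hit i (maxn M M0).
move=> /choice[g] /choice[K hK].
have [i [i' [ii' i'k e]]] := conj_pigeonhole c1 g.
have Mn a : (M <= n a)%N by have [/(leq_trans (leq_maxl _ _))] := hK a.
have M0n a : (M0 <= n a)%N by have [/(leq_trans (leq_maxr _ _))] := hK a.
have ik : (i <= k)%N by exact: leq_trans (ltnW ii') i'k.
have fy : translate (step (n i') (step_vec N i') + step (n i) (- step_vec N i))
    (translate (step (n i) (step_vec N i)) x) =
      translate (step (n i') (step_vec N i')) x.
  rewrite -translate_add -addrA; congr translate; rewrite -[RHS]addr0;
    congr (_ + _).
  apply/funext => a.
  by rewrite /step !fctE; case: ifP; rewrite ?addNr ?addr0.
exists i, i', (translate (step (n i) (step_vec N i)) x); split=> //.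
- exact: agree_step.
- exact: D_translate.
exists (step (n i) (step_vec N i)); split=> //.
exists (n i), (n i'); rewrite fy; split=> //.
  move=> m; have := small m ik (M0n i); have := small m i'k (M0n i').
  have := dist_triangle dP (theta x m) (theta (translate (step (n i') (step_vec
    N i')) x) m)
    (theta (translate (step (n i) (step_vec N i)) x) m).
  by rewrite (dist_sym dP (theta x m)); lra.
exists (maxn (K i) (K i')) => m; rewrite geq_max => /andP[Ki Ki'].
rewrite -(dist_mulr dP (theta x m)^-1%g) -!/(ratio _ _ _).
have := (hK i).2 m Ki; have := (hK i').2 m Ki'; rewrite -e.
have := dist_triangle dP (g i *
  c / g i)%g (ratio m (translate (step (n i') (step_vec N i')) x) x)
  (ratio m (translate (step (n i) (step_vec N i)) x) x).
by rewrite (dist_sym dP (g i * c / g i)%g); lra.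
Qed.

(** The translates found by [pair_near] agree with [x] on long prefixes, so they
accumulate at [x], where [pair_set] is decided. *)
Lemma pair_at_x M : exists i i', [/\ (i < i')%N, (i' <= k)%N &
  paired N (3 * inv q) (13 * inv p) M i i' x].
Proof.
suff h : pair_set N q p M x by exact: (rel_interior_sub Dx h).
have [//|[a ha]] := pair_decided N q p M.
have [i [i' [y [ii' i'k xy Dy [h [Dh yE [n [n' [Mn Mn' hb [K hK]]]]]]]]]] :=
  pair_near (maxn M a).
have [] := ha y (agreeW (leq_maxr _ _) xy).
have Df : Delta_shift (step n' (step_vec N i') +
  step n (- step_vec N i)) by apply: Delta_shift_add.
have [b hb'] : exists b, forall z, D z -> agree b y z -> forall m,
    d (theta (translate (step n' (step_vec N i') +
      step n (- step_vec N i)) z) m) (theta z m) <=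
    d (theta (translate (step n' (step_vec N i') +
      step n (- step_vec N i)) y) m) (theta y m) +
    Num.min (inv p) (inv q).
  have e0 : 0 < Num.min (inv p) (inv q) by rewrite lt_min !inv0.
  rewrite yE; have [b hb'] := uniform_translate Dh Df e0.
  exists b => z Dz yz m; have := hb' z Dz yz m.
  set f := _ + _; rewrite -!dist_ratio1 => h1.
  by have := dist_triangle dP (ratio m (translate f (translate h x)) (translate
    h x)) (ratio m (translate f z) z) 1%g; lra.
have := ge_min (inv p) (inv p) (inv q); have := ge_min (inv q) (inv p) (inv q).
rewrite !lexx orbT /=.
move: (Num.min _ _) hb' => e hb' eq ep.
exists b => z Dz yz; exists i, i'; split=> //; exists n, n'; split.
- by apply: leq_trans Mn; exact: leq_maxl.
- by apply: leq_trans Mn'; exact: leq_maxl.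
- by move=> m; have := hb' z Dz yz m; have := hb m; lra.
- by exists K => m Km; have := hb' z Dz yz m; have := hK m Km; lra.
Qed.
End Pairs.

(** The vector [w] can be reached at every translate of [x], starting as late as
desired, with bump essentially below [e] and with negligible effect. *)
Definition available (e : R) w := forall h, Delta_shift h -> forall M eta, 0 <
    eta ->
  exists (g : nat -> V) B, [/\ Delta_shift g, forall i, (i < M)%N -> g i = 0,
    forall i, (B <= i)%N -> g i = w,
    forall m, d (theta (translate g (translate h x)) m) (theta (translate h x)
      m) < e + eta &
    exists K, forall m, (K <= m)%N ->
      d (theta (translate g (translate h x)) m) (theta (translate h x) m) <
        eta].

Lemma available_local e w :
  (forall M eta, 0 < eta -> exists (g : nat -> V) B, [/\ Delta_shift g,
    forall i, (i < M)%N -> g i = 0, forall i, (B <= i)%N -> g i = w,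
    forall m, d (theta (translate g x) m) (theta x m) < e &
    exists K, forall m, (K <= m)%N ->
      d (theta (translate g x) m) (theta x m) < eta]) ->
  available e w.
Proof.
move=> loc h Dh M eta eta0; have eta2 : 0 < eta / 2 by lra.
have [n hn] := bump_transport Dh eta2.
have [g [B [Dg g0 gw gb [K hK]]]] := loc (maxn M n) _ eta2.
have hg := hn g Dg (translate_agree _ (fun i ni =>
  g0 i (leq_trans ni (leq_maxr _ _)))).
exists g, B; split=> //.
- by move=> i iM; rewrite g0 // (leq_trans iM) // leq_maxl.
- by move=> m; have := hg m; have := gb m; rewrite ltr_norml => ? /andP[]; lra.
- exists K => m Km; have := hg m; have := hK m Km; rewrite ltr_norml =>
  ? /andP[].
  by lra.
Qed.

Lemma available_pair q : inv q <= 1 / 2 -> exists N i i',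
  [/\ (i < i')%N, (i' <= k)%N & available (3 * inv q) (step_vec N i' -
    step_vec N i)].
Proof.
move=> q2; have [N /(_ N (leqnn N))[M0 small]] := small_steps (inv0 q).
pose P t (a : 'I_k.+1 * 'I_k.+1) := (a.1 < a.2)%N /\
  paired N (3 * inv q) (13 * inv t.+4) t a.1 a.2 x.
have p4 t : inv t.+4 < 1 / 4.
  by rewrite /invS div1r ltf_pV2 ?posrE ?ltr0n // ltr_nat.
have [t|t t' a tt' [? [n [n' [tn tn' hb [K hK]]]]]|a ha] :=
    @monotone_pigeonhole _ P.
- have [i [i' [ii' i'k h]]] := pair_at_x q2 (p4 t) (fun i n m => small i n m) t.
  by exists (Ordinal (leq_trans ii' (leqW i'k)), Ordinal (i'k : (i' < k.+1)%N)).
- split=> //; exists n, n'; split=> //;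
  [exact: leq_trans tn|exact: leq_trans tn'|].
  exists K => m /hK h; apply: lt_le_trans h _.
  by rewrite ler_pM2l // invS_le.
exists N, a.1, a.2; split; [by have [] := ha 0%N|exact: (ltn_ord a.2)|].
apply: available_local => M eta eta0.
have [p hp] := invS_lt (divr_gt0 eta0 (ltr0Sn _ 12)).
have [_ [n [n' [tn tn' hb [K hK]]]]] := ha (maxn M p).
exists (step n' (step_vec N a.2) + step n (- step_vec N a.1)), (maxn n n');
  split=> //.
- exact: Delta_shift_add.
- move=> i iM; rewrite !fctE /step.
  have late a' : (maxn M p <= a')%N -> (a' <= i)%N = false.
    by move=> /(leq_trans (leq_maxl _ _))/(leq_trans iM); rewrite ltnNge =>
      /negbTE.
  by rewrite !late ?addr0.
- by move=> i; rewrite geq_max => /andP[ni n'i]; rewrite !fctE /step ni n'i.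
- exists K => m /hK h; apply: lt_le_trans h _; rewrite mulrC -ler_pdivlMr //.
  apply: le_trans (ltW hp); apply: invS_le.
  by rewrite !leqW // leq_maxr.
Qed.

(** The bumps do not add up: the second piece starts only after the quotients
for the first one have settled near [1]. *)
Lemma available_add e w w' : available e w -> available e w' ->
  available e (w + w').
Proof.
move=> aw aw' h Dh M eta eta0; have eta2 : 0 < eta / 2 by lra.
have [g [B [Dg g0 gw gb [K hK]]]] := aw h Dh M _ eta2.
have Dgh : Delta_shift (g + h) by exact: Delta_shift_add.
have [n hn] := theta_continuous_upto K (D_translate Dgh Dx) eta2.
have [g' [B' [Dg' g0' gw' gb' [K' hK']]]] := aw' _ Dgh (maxn M n) _ eta2.
exists (g' + g), (maxn B B').
have late m : (m <= K)%N -> d (theta (translate g' (translate (g + h) x)) m)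
    (theta (translate (g + h) x) m) < eta / 2.
  move=> mK; apply: hn => //; first exact/D_translate/D_translate.
  by apply: translate_agree => i ni; apply/g0'/(leq_trans ni)/leq_maxr.
rewrite translate_add in gb' hK' late.
split.
- exact: Delta_shift_add.
- by move=> i iM; rewrite fctE g0 // g0' ?addr0 // (leq_trans iM) ?leq_maxl.
- by move=> i; rewrite geq_max fctE => /andP[/gw-> /gw'->]; rewrite addrC.
- move=> m; rewrite translate_add.
  have := dist_triangle dP (theta (translate g (translate h x)) m) (theta
    (translate g' (translate g (translate h x))) m)
    (theta (translate h x) m).
  case: (leqP m K) => [/late|/ltnW/hK]; first by have := gb m; lra.
  by have := gb' m; lra.
- exists (maxn K K') => m; rewrite geq_max translate_add => /andP[/hK + /hK'].
  have := dist_triangle dP (theta (translate g (translate h x)) m) (theta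
    (translate g' (translate g (translate h x))) m)
    (theta (translate h x) m).
  by lra.
Qed.

Lemma available_muln e w n : available e w -> available e (w *+ n.+1).
Proof. by move=> aw; elim: n => // n IH; rewrite mulrSr;
  exact: available_add. Qed.

Lemma availableW e e' w : e <= e' -> available e w -> available e' w.
Proof.
move=> ee' aw h Dh M eta eta0.
have [g [B [Dg g0 gw gb gK]]] := aw h Dh M eta eta0.
by exists g, B; split=> // m; apply: lt_le_trans (gb m) _; lra.
Qed.

(** A pair provides [2 ^- N] times a fixed vector; repeating it [2 ^ N] times
reaches that vector itself.  As only finitely many vectors occur, one of
them is available for all tolerances. *)
Lemma available_fixed : exists i i', [/\ (i < i')%N, (i' <= k)%N &
  forall e, 0 < e -> available e (step_vec 0 i' - step_vec 0 i)].
Proof.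
pose P t (a : 'I_k.+1 * 'I_k.+1) := (a.1 < a.2)%N /\
  available (3 * inv t.+1) (step_vec 0 a.2 - step_vec 0 a.1).
have [t|t t' a tt' [? av]|a ha] := @monotone_pigeonhole _ P.
- have t2 : inv t.+1 <= 1 / 2.
    by rewrite /invS div1r lef_pV2 ?posrE ?ltr0n // ler_nat.
  have [N [i [i' [ii' i'k av]]]] := available_pair t2.
  exists (Ordinal (leq_trans ii' (leqW i'k)), Ordinal (i'k : (i' < k.+1)%N)).
  split=> //=; rewrite -(step_vec_double N) -[step_vec 0 i](step_vec_double N)
    -mulrnBl.
  by rewrite -(prednK (expn_gt0 2 N)); exact: available_muln.
- split=> //; apply: availableW av; rewrite ler_pM2l //; exact: invS_le.
exists a.1, a.2; split; [by have [] := ha 0%N|exact: (ltn_ord a.2)|].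
move=> e e0; have [p hp] := invS_lt (divr_gt0 e0 (ltr0Sn _ 2)).
apply: availableW (ha p).2; rewrite mulrC -ler_pdivlMr //.
by apply: le_trans (ltW hp); exact/ltW/invS_ltS.
Qed.

(** Fusing infinitely many copies of an available vector [w], with bumps summing
to a finite total, gives translations [f] that take the value [w *+ t] for every
[t], while the quotients of [theta (f x)] by [theta x] are a uniform limit of
Cauchy sequences. *)
Lemma obstruction : False.
Proof.
have [i [i' [ii' i'k av]]] := available_fixed.
set w := step_vec 0 i' - step_vec 0 i in av.
(* Bumps bounded by these gaps have telescoping sums. *)
have gap0 j : 0 < inv j - inv j.+1 by rewrite subr_gt0 invS_ltS.
(* state: shift, index from which it is constant, start of the last piece *)
pose St := ((nat -> V) * nat * nat)%type.
pose P j (t t' : St) := let: (h, q, _) := t in let: (h', q', p') := t' in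
  Delta_shift h -> exists g : nat -> V, [/\
    [/\ Delta_shift h', h' = g + h & forall i, (q' <= i)%N -> g i = w],
    [/\ (j <= p')%N, (q < p')%N & (p' <= q')%N],
    forall i, (i < p')%N -> g i = 0,
    forall z, agree p' (translate h x) z -> W j z &
    forall m, d (theta (translate h' x) m) (theta (translate h x) m) < inv j -
      inv j.+1].
have [j t|s s0 sP] := @dependent_sequence _ ((0, 0%N, 0%N) : St) P.
  case: t => [[h q] p0].
  have [Dh|nDh] := pselect (Delta_shift h); last by exists (h, q, p0) => /nDh.
  have [n hn] := W_open (D_translate Dh Dx j).
  set p := maxn (maxn j q.+1) n.
  have e0 : 0 < (inv j - inv j.+1) / 2 by have := gap0 j; lra.
  have [g [B [Dg g0 gw gb _]]] := av _ e0 h Dh p _ e0.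
  exists (g + h, maxn p B, p) => _; exists g; split=> //.
  - split=> //; first exact: Delta_shift_add.
    by move=> l; rewrite geq_max => /andP[_]; exact: gw.
  - split; last exact: leq_maxl.
      by rewrite /p -maxnA leq_maxl.
    by rewrite /p !leq_max leqnn orbT.
  - by move=> z hz; apply/hn/(agreeW _ hz)/leq_maxr.
  - by move=> m; rewrite translate_add; have := gb m; lra.
pose hh j := (s j).1.1; pose q j := (s j).1.2; pose p j := (s j.+1).2.
have Dhh j : Delta_shift (hh j).
  elim: j => [|j]; first by rewrite /hh s0; exact: Delta_shift0.
  rewrite /hh; have := sP j; case: (s j) => [[h a] m] /=.
  by case: (s j.+1) => [[h' a'] m'] /= /[apply] -[g [[]]].
have {sP} sP j : exists g : nat -> V, [/\
    hh j.+1 = g + hh j /\ forall i, (q j.+1 <= i)%N -> g i = w,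
    [/\ (j <= p j)%N, (q j < p j)%N & (p j <= q j.+1)%N],
    forall i, (i < p j)%N -> g i = 0,
    forall z, agree (p j) (translate (hh j) x) z -> W j z &
    forall m, d (theta (translate (hh j.+1) x) m) (theta (translate (hh j) x)
      m) <
      inv j - inv j.+1].
  have := sP j; have := Dhh j; rewrite /hh /p /q.
  case: (s j) => [[h a] m] /=; case: (s j.+1) => [[h' a'] m'] /=.
  by move=> Dh /(_ Dh) [g [[? ? ?] ? ? ? ?]]; exists g; split.
have jp j : (j <= p j)%N by have [g [_ []]] := sP j.
have pp j : (p j <= p j.+1)%N.
  have [_ [_ [_ _ h] _ _ _]] := sP j; have [_ [_ [_ h' _] _ _ _]] := sP j.+1.
  exact: leq_trans h (ltnW h').
pose f n := hh n.+1 n.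
have lim j : agree (p j) (hh j) f.
  apply: agree_limit => // l a ap; have [g [[-> _] _ h _ _]] := sP l.
  by rewrite fctE h // add0r.
have xlim j : agree (p j) (translate (hh j) x) (translate f x).
  by move=> a /lim e; rewrite /translate /seq_mul e.
have hq j a : (q j <= a)%N -> hh j a = w *+ j.
  elim: j a => [|j IH] a; first by rewrite /hh s0.
  have [g [[-> hg] [_ qp pq] _ _ _]] := sP j => qa.
  by rewrite fctE hg // IH ?mulrS // (leq_trans (leq_trans (ltnW qp) pq)).
apply: (@unbounded_not_Cauchy i i' f x) => //.
  move=> t; exists (q t); rewrite -(lim t) ?hq //.
  by have [_ [_ [_ ? _] _ _ _]] := sP t.
have Df : D (translate f x) by move=> l; have [_ [_ _ _ h _]] := sP l;
  exact/h/xlim.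
have near_hh j t m : d (theta (translate (hh (j +
  t)%N) x) m) (theta (translate (hh j) x) m) <=
    inv j - inv (j + t).
  elim: t => [|t IH]; first by rewrite addn0 (dist_xx dP) subrr.
  rewrite addnS; have [_ [_ _ _ _ /(_ m)]] := sP (j + t)%N.
  have := dist_triangle dP (theta (translate (hh (j +
    t)%N) x) m) (theta (translate (hh (j + t).+1%N) x) m)
    (theta (translate (hh j) x) m).
  by lra.
have near_f j m : d (theta (translate f x) m) (theta (translate (hh j) x) m) <=
  2 * inv j.
  have [n hn] := theta_continuous m Df (inv0 j).
  have /hn : D (translate (hh (j + n)%N) x) by exact: D_translate.
  have /[swap]/[apply] : agree n (translate f x) (translate (hh (j + n)%N) x).
    by apply/agreeC/(agreeW _ (@xlim _))/(leq_trans _ (jp _))/leq_addl.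
  have := near_hh j n m; have := inv0 (j + n).
  have := dist_triangle dP (theta (translate (hh (j +
    n)%N) x) m) (theta (translate f x) m)
    (theta (translate (hh j) x) m).
  by rewrite (dist_sym dP (theta (translate f x) m) (theta (translate (hh (j +
    n)%N) x) m)); lra.
move=> e e0; have e5 : 0 < e / 5 by lra.
have [j hj] := invS_lt e5.
have [K hK] := Delta_Cauchy x (Dhh j) (inv0 j).
exists K => m m' Km Km'.
have := near_f j m; have := near_f j m'; have := hK m m' Km Km'.
rewrite -(dist_mulr dP (theta x m)^-1%g (theta (translate f x) m)) -!/(ratio _
  _ _).
rewrite -(dist_mulr dP (theta x m')^-1%g (theta (translate f x) m')) -!/(ratio
  _ _ _).
have := dist_triangle dP (ratio m (translate (hh j) x) x) (ratio m (translate f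
  x) x) (ratio m' (translate f x) x).
have := dist_triangle dP (ratio m' (translate (hh j) x) x) (ratio m (translate
  (hh j) x) x) (ratio m' (translate f x) x).
rewrite (dist_sym dP (ratio m' (translate (hh j) x) x) (ratio m' (translate f
  x) x)) /translate.
by lra.
Qed.

End GenericPoint.

Theorem no_Cauchy_reduction : False.
Proof.
have [W Wod [D_Delta theta_cont]] := continuity_points.
suff /(_ seq_one 0%N)[x _ [Dx [[h1 h2] [h3 h4]]]] :
   prefix_dense [set x | (forall l, W l x) /\
   (((forall a b p N,
     decided (rel_interior W (spread (enum_Delta b) (inv p) N)) (seq_mul
       (enum_Delta a) x)) /\
    (forall j i N l p M, decided (hit_set W N l p M) (seq_mul (unrotate_from j
      i) x))) /\
   ((forall N l p,
     decided (exterior [set z | forall M, hit_set W N l p M z]) x) /\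
    (forall N q p M, decided (pair_set W N q p M) x)))].
  by apply: (@obstruction W _ _ _ x) => // l; have [] := Wod l.
apply: comeager_dense; apply: comeagerI; first by exists W.
apply: comeagerI; apply: comeagerI.
- do 4 apply: comeager_forall => ?.
  by apply: comeager_seq_mul; apply: comeager_decided; exact: rel_interior_open.
- do 6 apply: comeager_forall => ?.
  by apply: comeager_seq_mul; apply: comeager_decided; exact: rel_interior_open.
- by do 3 apply: comeager_forall => ?;
    apply: comeager_decided; exact: exterior_open.
- by do 4 apply: comeager_forall => ?;
    apply: comeager_decided; exact: rel_interior_open.
Qed.

End Obstruction.

(** * The metric of a semidirect product of rotations *)

Section EuclideanNorm.
Variable R : realType.
Implicit Types (u v w : 'cV[R]_2) (t : R).

(** The norm of ['cV_2] is the maximum norm, which rotations do not preserve. *)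
Definition enorm v := Num.sqrt (v ord0 ord0 ^+ 2 + v ord_max ord0 ^+ 2).

Lemma enorm_ge0 v : 0 <= enorm v. Proof. exact: sqrtr_ge0. Qed.

Lemma enorm0 : enorm 0 = 0.
Proof. by rewrite /enorm !mxE expr0n addr0 sqrtr0. Qed.

Lemma enormN v : enorm (- v) = enorm v.
Proof. by rewrite /enorm !mxE !sqrrN. Qed.

Lemma enormBC u v : enorm (u - v) = enorm (v - u).
Proof. by rewrite -enormN opprB. Qed.

Lemma enormD u v : enorm (u + v) <= enorm u + enorm v.
Proof.
rewrite -(ler_pXn2r (n := 2)) ?nnegrE ?addr_ge0 ?enorm_ge0 //.
rewrite sqrrD /enorm !sqr_sqrtr ?addr_ge0 ?sqr_ge0 // !mxE.
rewrite -sqrtrM ?addr_ge0 ?sqr_ge0 //.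
set a := u _ _; set b := u _ _; set c := v _ _; set e := v _ _.
suff : a * c + b * e <= Num.sqrt ((a ^+ 2 + b ^+ 2) * (c ^+ 2 + e ^+ 2)).
  by rewrite mulr2n; lra.
apply: le_trans (ler_norm _) _; rewrite -sqrtr_sqr ler_wsqrtr //.
by have := sqr_ge0 (a * e - b * c); nra.
Qed.

Lemma coord_le_enorm v i : `|v i ord0| <= enorm v.
Proof.
rewrite -sqrtr_sqr; apply: ler_wsqrtr.
case: i => -[|[|//]] iP.
  by rewrite (_ : Ordinal iP = ord0) ?lerDl ?sqr_ge0 //; exact: val_inj.
by rewrite (_ : Ordinal iP = ord_max) ?lerDr ?sqr_ge0 //; exact: val_inj.
Qed.

Lemma enorm_le_coord v :
  enorm v <= `|v ord0 ord0| + `|v ord_max ord0|.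
Proof.
rewrite -(ler_pXn2r (n := 2)) ?nnegrE ?addr_ge0 ?enorm_ge0 //.
rewrite /enorm sqr_sqrtr ?addr_ge0 ?sqr_ge0 // sqrrD !real_normK ?num_real //.
by rewrite addrAC lerDl mulrn_wge0 // mulr_ge0.
Qed.

Lemma enorm_eq0 v : enorm v = 0 -> v = 0.
Proof.
move=> v0; apply/matrixP => i j; rewrite (ord1 j) mxE.
by apply/eqP; rewrite -normr_le0 -v0 coord_le_enorm.
Qed.

Lemma enorm_rot t v : enorm (rot_mx t *m v) = enorm v.
Proof.
rewrite /enorm !mxE !big_ord_recl !big_ord0 !addr0 !mxE /=.
rewrite (_ : lift ord0 ord0 = ord_max); last exact: val_inj.
congr Num.sqrt; set c := cos _; set s := sin _.
have h : c ^+ 2 + s ^+ 2 = 1 by exact: cos2Dsin2.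
set a := v _ _; set b := v _ _.
by transitivity ((c ^+ 2 + s ^+ 2) * (a ^+ 2 + b ^+ 2)); [ring|rewrite h mul1r].
Qed.

End EuclideanNorm.

Section SemidirectMetric.
Variables (R : realType) (L : gl2_subgroup R).
Hypothesis L_isometry : forall A, gl2_set L A -> forall v, enorm (A *m v) =
    enorm v.
Local Notation G := (semidirect L).
Implicit Types (x y z : G) (e : R).

(** The value [1] on distinct rotation parts is what makes this invariant on the
right: right multiplication moves the translation parts of such elements
arbitrarily far apart.  The minimum keeps the triangle inequality. *)
Definition sdist x y : R :=
  if val x.1 == val y.1 then Num.min 1 (enorm (x.2 - y.2)) else 1.

Lemma sdist_le1 x y : sdist x y <= 1.
Proof. by rewrite /sdist; case: ifP => // _; rewrite ge_min lexx. Qed.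

Lemma sdist_ge0 x y : 0 <= sdist x y.
Proof. by rewrite /sdist; case: ifP => // _;
  rewrite le_min ler01 enorm_ge0. Qed.

Lemma sdist_lt1 x y e : e <= 1 -> sdist x y < e ->
  val x.1 = val y.1 /\ enorm (x.2 - y.2) < e.
Proof.
rewrite /sdist; case: eqP => [-> e1|_ e1]; last by rewrite ltNge e1.
by rewrite gt_min ltNge e1 /=.
Qed.

Lemma sdist_same x y : val x.1 = val y.1 -> sdist x y <= enorm (x.2 - y.2).
Proof. by rewrite /sdist => ->; rewrite eqxx ge_min lexx orbT. Qed.

Lemma valL x : gl2_set L (val x.1). Proof. exact: (set_mem (valP x.1)). Qed.

Lemma val_unit x : val x.1 \in unitmx. Proof. exact/gl2_set_unit/valL. Qed.

Lemma sdist_metric : biinvariant_metric sdist.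
Proof.
split.
- by move=> x; rewrite /sdist eqxx subrr enorm0; apply/min_idPr; exact: ler01.
- by move=> x y; rewrite /sdist eq_sym enormBC.
- move=> y x z; have [xy|xy] := eqVneq (val x.1) (val y.1); last first.
    apply: le_trans (sdist_le1 _ _) _; rewrite {1}/sdist (negbTE xy).
    by rewrite lerDl sdist_ge0.
  have [yz|yz] := eqVneq (val y.1) (val z.1); last first.
    apply: le_trans (sdist_le1 _ _) _; rewrite {2}/sdist (negbTE yz).
    by rewrite lerDr sdist_ge0.
  rewrite /sdist xy yz eqxx.
  have := enormD (x.2 - y.2) (y.2 - z.2); rewrite addrA subrK => h.
  have := enorm_ge0 (x.2 - y.2); have := enorm_ge0 (y.2 - z.2).
  by rewrite !minEle; case: ifP => ?; case: ifP => ?; case: ifP => ?; lra.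
- move=> z x y; rewrite /sdist /=.
  rewrite (inj_eq (can_inj (mulKmx (val_unit z)))).
  case: eqP => // _; rewrite opprD addrACA subrr add0r -mulmxBr.
  by rewrite L_isometry //; exact: valL.
- move=> z x y; rewrite /sdist /= (inj_eq (can_inj (mulmxK (val_unit z)))).
  by case: eqP => // ->; rewrite opprD addrACA subrr addr0.
Qed.

Lemma nbhs_sdist x (U : set G) :
  nbhs x U <-> exists2 e, 0 < e & forall y, sdist x y < e -> U y.
Proof.
split=> [[[P Q] /= [Px Qx] PQU]|[e e0 eU]].
  have [e e0 eQ] := (nbhs_ballP x.2 Q).1 Qx.
  exists (Num.min 1 e) => [|[A t]]; first by rewrite lt_min ltr01.
  move=> /[dup] xy /sdist_lt1 []; first by rewrite ge_min lexx.
  move=> xy1 xy2; have {xy} xy2 : enorm (x.2 - t) < e.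
    by apply: lt_le_trans xy2 _; rewrite ge_min lexx orbT.
  apply: PQU; split=> /=; last first.
    apply: eQ; split=> // i j; rewrite (ord1 j) /ball /=.
    by apply: le_lt_trans xy2; have := coord_le_enorm (x.2 - t) i; rewrite !mxE.
  by rewrite (_ : A = x.1); [exact: nbhs_singleton|exact/esym/val_inj].
exists ([set x.1], ball x.2 (e / 2)).
  split; first exact: discrete_set1.
  by apply: nbhsx_ballx; lra.
move=> [A t] /= [-> [_ xt]]; apply: eU.
apply: le_lt_trans (sdist_same _) _ => //=.
apply: le_lt_trans (enorm_le_coord _) _.
have := xt ord0 ord0; have := xt ord_max ord0; rewrite /ball /= !mxE.
by lra.
Qed.

Lemma sdist_ball_open c e : open [set x : G | sdist x c < e].
Proof.
rewrite openE => x /= xc; apply/nbhs_sdist; exists (e - sdist x c).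
  by rewrite subr_gt0.
move=> y xy; have := dist_triangle sdist_metric x y c.
by rewrite (dist_sym sdist_metric y x) /=; lra.
Qed.

(** Convergence in the product of a discrete space and the plane. *)
Lemma cvgn_coord (z : nat -> G) : cvgn z <->
  (exists K, forall m, (K <= m)%N -> val (z m).1 = val (z K).1) /\
  forall i, cvgn (fun m => (z m).2 i ord0).
Proof.
split=> [/cvg_ex[l zl]|[[K zK] zc]].
  have near_l e : 0 < e -> exists K, forall m, (K <= m)%N -> sdist l (z m) < e.
    move=> e0; have /zl[K _ hK] : nbhs l [set y | sdist l y < e].
      by apply/nbhs_sdist; exists e.
    by exists K => m /hK.
  split=> [|i].
    have [K hK] := near_l 1 ltr01; exists K => m Km.
    have [<- _] := sdist_lt1 (lexx 1) (hK m Km).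
    by have [<- _] := sdist_lt1 (lexx 1) (hK K (leqnn _)).
  apply/cvg_ex; exists (l.2 i ord0); apply/cvgrPdist_lt => e e0.
  have [|K hK] := near_l (Num.min 1 e); first by rewrite lt_min ltr01.
  exists K => // m /hK h; have [|_ h'] := sdist_lt1 _ h;
    first by rewrite ge_min lexx.
  apply: (@lt_le_trans _ _ (Num.min 1 e)); last by rewrite ge_min lexx orbT.
  by apply: le_lt_trans h'; have := coord_le_enorm (l.2 - (z m).2) i;
    rewrite !mxE.
pose t : 'cV[R]_2 := \col_i limn (fun m => (z m).2 i ord0).
apply/cvg_ex; exists ((z K).1, t) => U /nbhs_sdist[e e0 eU].
have e2 : 0 < e / 2 by lra.
have near_t i : \forall m \near \oo, `|t i ord0 - (z m).2 i ord0| < e / 2.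
  by rewrite mxE; exact: (@cvgrPdist_lt _ _ _ _ _ _ _).1 (zc i) _ e2.
have nearK : \forall m \near \oo, (K <= m)%N by exists K.
apply: filterS3 nearK (near_t ord0) (near_t ord_max) => m Km h0 h1; apply: eU.
apply: le_lt_trans (@sdist_same ((z K).1, t) (z m) (esym (zK m Km))) _.
apply: le_lt_trans (enorm_le_coord _) _ => /=.
by move: h0 h1; rewrite !mxE; lra.
Qed.

Lemma cvgn_sdist (z : nat -> G) : cvgn z <->
  forall e, 0 < e -> exists K, forall m m', (K <= m)%N -> (K <= m')%N ->
    sdist (z m) (z m') < e.
Proof.
split=> [/cvg_ex[l zl] e e0|zC].
  have e2 : 0 < e / 2 by lra.
  have /zl : nbhs l [set y | sdist l y < e / 2] by apply/nbhs_sdist;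
    exists (e / 2).
  move=> [K _ hK]; exists K => m m' Km Km'.
  have := dist_triangle sdist_metric l (z m) (z m');
    rewrite (dist_sym sdist_metric (z m) l).
  by have := hK m Km; have := hK m' Km'; rewrite /=; lra.
apply/cvgn_coord; split=> [|i].
  have [K hK] := zC 1 ltr01; exists K => m Km.
  by have [] := sdist_lt1 (lexx 1) (hK m K Km (leqnn _)).
apply/cauchy_cvgP/cauchy_exP => e e0.
have e1 : 0 < Num.min 1 e by rewrite lt_min ltr01.
have [K hK] := zC _ e1.
exists ((z K).2 i ord0); exists K => // m Km; rewrite /ball /=.
have [|_ h] := sdist_lt1 _ (hK _ _ (leqnn _) Km); first by rewrite ge_min lexx.
apply: (@lt_le_trans _ _ (Num.min 1 e)); last by rewrite ge_min lexx orbT.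
by apply: le_lt_trans h; have := coord_le_enorm ((z K).2 - (z m).2) i;
  rewrite !mxE.
Qed.

Definition translation (v : 'cV[R]_2) : G := ((1%g : G).1, v).

Lemma translationD v w : translation (v + w) = (translation v *
    translation w)%g.
Proof. by congr pair; [apply: val_inj;
  rewrite /= mul1mx|rewrite /= mul1mx]. Qed.

Lemma conj_translation (g c : G) : val c.1 = 1%:M ->
  (g * c / g)%g = (c.1, val g.1 *m c.2) :> G.
Proof.
move=> c1.
rewrite (_ : (g * c / g)%g = ((g * c / g)%g.1, (g * c / g)%g.2));
  last by case: (_ / _)%g.
congr pair => /=; first by apply: val_inj;
  rewrite /= c1 mulmx1 mulmxV ?(val_unit g).
by rewrite c1 mulmx1 mulmxN mulmxA mulmxV ?(val_unit g) // mul1mx addrAC subrr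
  add0r.
Qed.

End SemidirectMetric.

(** * Borel maps have the Baire property *)

Section BorelBaire.

(** A sequence of points that agree with [x] on longer and longer prefixes
converges to [x] pointwise, whatever the topology of [T]. *)
Lemma ptws_open_prefix (T : ptopologicalType) (U : set {ptws nat -> T}) :
  open U -> @prefix_open T U.
Proof.
rewrite openE => oU x Ux; apply: contrapT => /forallNP nU.
have /choice[y hy] : forall n, exists y : nat -> T, agree n x y /\ ~ U y.
  move=> n; apply: contrapT => h; apply: (nU n) => y xy.
  by apply: contrapT => Uy; apply: h; exists y.
have yx : (y : nat -> {ptws nat -> T}) @ \oo --> (x : {ptws nat -> T}).
  apply/cvg_sup => N V [V'] [[W] oW <-] WfN WU.
  apply: (filterS WU); rewrite nbhs_simpl; exists N.+1 => // i /= Ni.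
  by rewrite /proj -((hy i).1 N).
have [N _ /(_ N (leqnn N))] := yx U (oU _ Ux).
exact: (hy N).2.
Qed.

Lemma borel_map_Baire (T T' : ptopologicalType)
    (f : {ptws nat -> T} -> T') (B : set T') :
  borel_map f -> open B -> @Baire_property T (f @^-1` B).
Proof.
move=> bf oB.
have : (<<s (@open {ptws nat -> T}) >> : set _) (f @^-1` B).
  by rewrite -[_ @^-1` _]setTI; apply: bf => //; exact: sub_sigma_algebra.
apply: smallest_sub; first exact: Baire_property_sigma.
by move=> U oU; exact/Baire_property_open/ptws_open_prefix.
Qed.

End BorelBaire.

(** * Rotations of the plane *)

Section Rotations.
Variable R : realType.

Lemma cos2pi_eq1 (t : R) : cos (2 * pi * t) = 1 -> exists z : int, t = z%:~R.
Proof.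
move=> ct; exists (Num.floor t); apply/eqP; rewrite -subr_eq0.
set s := t - _.
have s0 : 0 <= s by rewrite subr_ge0 ge_floor.
have s1 : s < 1 by rewrite ltrBlDl -intrD1 floorD1_gt.
have per (n : nat) (u : R) : cos (u + pi *+ 2 *+ n) = cos u.
  elim: n => [|n IH]; first by rewrite mulr0n addr0.
  by rewrite mulrS addrCA addrC cosD2pi.
have cs : cos (2 * pi * s) = 1.
  rewrite /s -[RHS]ct; case: (Num.floor t) => n.
    rewrite -[LHS](per n); congr cos.
    by rewrite mulrBr -[pi *+ 2 *+ n]mulr_natr -(mulr_natl pi 2) -pmulrn subrK.
  rewrite NegzE -[RHS](per n.+1); congr cos.
  by rewrite intrN opprK mulrDr -[pi *+ 2 *+ _]mulr_natr -(mulr_natl pi 2)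
    -pmulrn.
apply: contraT => sn0.
have {}s0 : 0 < s by rewrite lt_neqAle eq_sym sn0.
have p0 := pi_gt0 R.
have sps : 0 < sin (pi * s).
  by apply: sin_gt0_pi; rewrite mulr_gt0 //= gtr_pMr.
have := cos_mulr2n (pi * s); rewrite cos2sin2.
rewrite (_ : pi * s *+ 2 = 2 * pi * s); last by ring.
rewrite cs; move: (exprn_gt0 2 sps); move: (sin _ ^+ 2) => x; rewrite mulr2n.
by lra.
Qed.

Lemma rot_eq1 (t : R) : rot_mx t = 1%:M -> exists z : int, t = z%:~R.
Proof.
by move=> /matrixP/(_ ord0 ord0); rewrite !mxE /= => /cos2pi_eq1.
Qed.

(** The exponent of [2] is odd on one side of [2 m^2 = z^2] and even on the
other. *)
Lemma sqrt2_irrational (m z : int) :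
  Num.sqrt (2 : R) * m%:~R = z%:~R -> m = 0.
Proof.
move=> /(congr1 (fun x => x ^+ 2)); rewrite exprMn sqr_sqrtr //.
have sqr_abs (a : int) : a%:~R ^+ 2 = `|a|%N%:R ^+ 2 :> R.
  by rewrite natr_absz intr_norm real_normK ?num_real.
rewrite !sqr_abs -!natrX -natrM => /eqP; rewrite eqr_nat => /eqP e.
apply/eqP; rewrite -absz_eq0; case: posnP => // m0.
have z0 : (0 < `|z|)%N.
  by rewrite lt0n; apply/eqP => z0; move: e; rewrite z0; nia.
have := congr1 (logn 2) e; rewrite lognM ?expn_gt0 ?m0 // !lognX.
by rewrite (pfactorK 1) //; lia.
Qed.

End Rotations.

(** * The group with finitely many rotations *)

Section FiniteRotations.
Variables (R : realType) (k : nat).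
Local Notation G := (semidirect (Gamma R k)).

Lemma Gamma_isometry A : gl2_set (Gamma R k) A -> forall v, enorm (A *m v) =
    enorm v.
Proof. by move=> [i _ <-] v; exact: enorm_rot. Qed.

Lemma Gamma_set_rot i : (i <= k)%N ->
    gl2_set (Gamma R k) (rot_mx (i%:R / k%:R)).
Proof. by move=> ik; exists i. Qed.

(** A conjugate of a translation depends only on the rotation part of the
conjugating element, and there are only [k] rotations because the indices [0]
and [k] give the same one. *)
Lemma Gamma_conj_pigeonhole : (0 < k)%N -> forall c : G, sdist c 1%g < 1 ->
  forall g : nat -> G, exists i i', [/\ (i < i')%N, (i' <= k)%N &
    (g i * c / g i = g i' * c / g i')%g].
Proof.
move=> k0 c /(sdist_lt1 (lexx 1))[c1 _] g.
have /choice[h hP] : forall i : 'I_k.+1, exists j : 'I_k,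
    val (g i).1 = rot_mx (j%:R / k%:R).
  move=> i; have [j jk <-] := valL (g i).
  have [jk'|kj] := ltnP j k; first by exists (Ordinal jk').
  exists (Ordinal k0) => /=.
  have -> : j = k by apply/eqP; rewrite eqn_leq kj andbT.
  rewrite divff ?pnatr_eq0 -?lt0n // mul0r -[X in rot_mx X]add0r.
  by rewrite rotD1.
have /injectivePn[i [i' ii' hii']] : ~~ injectiveb h.
  apply/negP => /injectiveP/leq_card; rewrite !card_ord.
  by rewrite ltnn.
have e : (g i * c / g i = g i' * c / g i')%g.
  by rewrite !conj_translation // !hP hii'.
have : (i : nat) != i' by [].
rewrite neq_ltn => /orP[ltii'|ltii'].
  by exists i, i'; split=> //; rewrite -ltnS ltn_ord.
by exists i', i; split=> //; rewrite -ltnS ltn_ord.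
Qed.

Let grid_code := (nat * nat * int * int)%type.

(** All denominators together give a dense set, and a single large denominator
gives finite nets of the unit ball. *)
Definition grid_vec (n : nat) (p q : int) : 'cV[R]_2 :=
  \col_i (if i == ord0 then p%:~R / n.+1%:R else q%:~R / n.+1%:R).

(** [minn] makes the code total. *)
Definition grid_elt (a : grid_code) : G := let: (i, n, p, q) := a in
  (exist _ (rot_mx ((minn i k)%:R / k%:R)) (mem_set (Gamma_set_rot (geq_minr i
    k))),
   grid_vec n p q).

Lemma grid_approx (n : nat) (t : 'cV[R]_2) : exists p q : int,
  [/\ enorm (t - grid_vec n p q) <= 2 * invS R n,
    p%:~R <= t ord0 ord0 * n.+1%:R < (p + 1)%:~R &
    q%:~R <= t ord_max ord0 * n.+1%:R < (q + 1)%:~R].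
Proof.
have n0 : 0 < n.+1%:R :> R by rewrite ltr0n.
have approx (x : R) : exists2 p : int, p%:~R <= x * n.+1%:R < (p + 1)%:~R &
    `|x - p%:~R / n.+1%:R| <= invS R n.
  exists (Num.floor (x * n.+1%:R)); first exact: floor_itv.
  have := floor_itv (x * n.+1%:R); rewrite intrD1; move: (Num.floor _)%:~R => y.
  rewrite -ler_pdivrMr // -ltr_pdivlMr // mulrDl mul1r -/(invS R n).
  by move=> /andP[h1 h2]; rewrite ler_norml; apply/andP; split; have :=
    invS_gt0 R n; lra.
have [p hp h1] := approx (t ord0 ord0); have [q hq h2] :=
  approx (t ord_max ord0).
exists p, q; split=> //; apply: le_trans (enorm_le_coord _) _.
by rewrite !mxE /=; lra.
Qed.

Definition grid (l : nat) : G := grid_elt (odflt (0%N, 0%N, 0, 0) (unpickle l)).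

Lemma gridE a : grid (pickle a) = grid_elt a.
Proof. by rewrite /grid pickleK. Qed.

Lemma grid_dense (c : G) e : 0 < e -> exists l, sdist c (grid l) < e.
Proof.
move=> e0; have [n hn] := invS_lt (divr_gt0 e0 (ltr0Sn _ 1)).
have [i ik ci] := valL c; have [p [q [h _ _]]] := grid_approx n c.2.
exists (pickle (i, n, p, q)); rewrite gridE.
apply: le_lt_trans (sdist_same _) _.
  by rewrite -ci /=; move/minn_idPl : (ik : (i <= k)%N) => ->.
rewrite [X in enorm X](_ : _ = c.2 - grid_vec n p q) //.
by apply: le_lt_trans h _; rewrite mulrC -ltr_pdivlMr.
Qed.

Lemma grid_bounded e : 0 < e -> exists L, forall c : G, sdist c 1%g < 1 ->
  exists2 l, (l < L)%N & sdist c (grid l) < e.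
Proof.
move=> e0; have [n hn] := invS_lt (divr_gt0 e0 (ltr0Sn _ 1)).
pose code (p q : 'I_(2 * n.+2)) : grid_code :=
  (0%N, n, p%:Z - n.+2%:Z, q%:Z - n.+2%:Z).
exists (\max_(pq : 'I_(2 * n.+2) * 'I_(2 * n.+2)) pickle (code pq.1 pq.2)).+1.
move=> c /(sdist_lt1 (lexx 1))[c1 c2].
have [p [q [h hp hq]]] := grid_approx n c.2.
have range (i : 'I_2) (r : int) : r%:~R <= c.2 i ord0 * n.+1%:R < (r + 1)%:~R ->
    exists s : 'I_(2 * n.+2), r = s%:Z - n.+2%:Z.
  have := coord_le_enorm (c.2 - (1%g : G).2) i; rewrite !mxE subr0 =>
    /le_lt_trans/(_ c2).
  have n0 : 0 < n.+1%:R :> R by rewrite ltr0n.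
  rewrite ltr_norml => /andP[x1 x2] /andP[r1 r2].
  have r1' : (r < n.+1%:Z)%R.
    rewrite -(ltr_int R); apply: le_lt_trans r1 _.
    by rewrite -pmulrn gtr_pMl.
  have r2' : (- n.+1%:Z < r + 1)%R.
    rewrite -(ltr_int R); apply: lt_trans r2.
    by rewrite intrN -pmulrn -[X in - X]mul1r -mulNr ltr_pM2r.
  have sP : (absz (r + n.+2%:Z)%R < 2 * n.+2)%N by clear -r1' r2'; lia.
  by exists (Ordinal sP) => /=; clear -r1' r2'; lia.
have [p' pE] := range _ _ hp; have [q' qE] := range _ _ hq.
exists (pickle (code p' q')).
  by rewrite ltnS; exact: (leq_bigmax (p', q')).
rewrite gridE; apply: le_lt_trans (sdist_same _) _.
  by rewrite c1 /= min0n mul0r Defs.rot0.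
rewrite [X in enorm X](_ : _ = c.2 - grid_vec n p q); last by rewrite pE qE.
by apply: le_lt_trans h _; rewrite mulrC -ltr_pdivlMr.
Qed.

End FiniteRotations.

(** * The group generated by one irrational rotation *)

Section EuclideanNormSums.
Variable R : realType.
Implicit Types v w : 'cV[R]_2.

Lemma enormZ (a : R) v : enorm (a *: v) = `|a| * enorm v.
Proof.
rewrite /enorm !mxE !exprMn -mulrDr sqrtrM ?sqr_ge0 //.
by rewrite sqrtr_sqr.
Qed.

Lemma enorm_muln v n : enorm (v *+ n) = enorm v * n%:R.
Proof. by rewrite -scaler_nat enormZ normr_nat mulrC. Qed.

Lemma enorm_sum (I : Type) (s : seq I) (P : pred I) (F : I -> 'cV[R]_2) :
  enorm (\sum_(i <- s | P i) F i) <= \sum_(i <- s | P i) enorm (F i).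
Proof.
elim/big_rec2: _ => [|i y v _ h]; first by rewrite enorm0.
by apply: le_trans (enormD _ _) _; rewrite lerD2l.
Qed.

Lemma half_expr_le n : (2^-1 : R) ^+ n <= invS R n.
Proof.
rewrite exprVn /invS lef_pV2 ?posrE ?exprn_gt0 ?ltr0n //.
by rewrite -natrX ler_nat ltn_expl.
Qed.

Lemma geometric_tail J m :
  \sum_(J <= j < m) (2^-1 : R) ^+ j <= 2 * 2^-1 ^+ J.
Proof.
have [mJ|Jm] := leqP m J.
  by rewrite big_geq // mulr_ge0 // exprn_ge0 // invr_ge0.
suff -> : \sum_(J <= j < m) (2^-1 : R) ^+ j = 2 * 2^-1 ^+ J - 2 * 2^-1 ^+ m.
  by rewrite gerBl mulr_ge0 // exprn_ge0 // invr_ge0.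
rewrite -(subnKC (ltnW Jm)); elim: (m - J)%N => [|t IH].
  by rewrite addn0 big_geq // subrr.
rewrite addnS big_nat_recr ?leq_addr //= IH exprS.
by field.
Qed.

(** Once the first [J] terms have all entered the sum, whatever their delays, only
terms of the tail remain to enter it. *)
Lemma delayed_sum_Cauchy (c : R) (p : nat -> nat) (v : nat -> 'cV[R]_2) :
  (forall j, enorm (v j) <= c * 2^-1 ^+ j) ->
  let F n := \sum_(j < n.+1 | (p j <= n)%N) v j in
  forall e, 0 < e -> exists K, forall m m', (K <= m)%N -> (K <= m')%N ->
    enorm (F m - F m') < e.
Proof.
move=> vc F e e0.
have c0 : 0 <= c.
  by have := vc 0%N; rewrite expr0 mulr1; apply: le_trans; exact: enorm_ge0.
have e1 : 0 < e / (4 * c + 1) by rewrite divr_gt0 //; lra.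
have [J hJ] := invS_lt e1.
exists (maxn J (\max_(j < J) p j)).
have tail m : (maxn J (\max_(j < J) p j) <= m)%N ->
    enorm (F m - \sum_(0 <= j < J) v j) <= 2 * c * 2^-1 ^+ J.
  rewrite geq_max => /andP[Jm pm].
  have -> : F m = \sum_(0 <= j < J) v j + \sum_(J <= j < m.+1 | (p j <=
    m)%N) v j.
    rewrite /F -(big_mkord (fun j => p j <= m)%N).
    rewrite [LHS](@big_cat_nat _ _ _ J) ?(leqW Jm) //=; congr (_ + _).
    rewrite big_nat_cond [RHS]big_nat_cond; apply: eq_bigl => j.
    case/boolP: (0 <= j < J)%N => //= jJ.
    by rewrite (leq_trans _ pm) // (leq_bigmax (Ordinal jJ)).
  rewrite addrC addKr; apply: le_trans (enorm_sum _ _ _) _.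
  rewrite -mulrA mulrCA.
  apply: le_trans (ler_wpM2l c0 (geometric_tail J m.+1)).
  rewrite mulr_sumr [leLHS]big_mkcond; apply: ler_sum => j _.
  by case: ifP => // _; rewrite mulr_ge0 // exprn_ge0 // invr_ge0.
move=> m m' /tail h1 /tail h2.
have := enormD (F m - \sum_(0 <= j < J) v j) (\sum_(0 <= j < J) v j - F m').
rewrite addrA subrK (enormBC (\sum_(0 <= j < J) v j)) => h3.
have h4 : c * 2^-1 ^+ J <= c * invS R J by rewrite ler_wpM2l // half_expr_le.
have h5 : invS R J * (4 * c + 1) < e by rewrite -ltr_pdivlMr //; lra.
by have := invS_gt0 R J; lra.
Qed.

End EuclideanNormSums.

Section Source.
Variable R : realType.
Local Notation H := (semidirect (Gammaz R)).
Local Notation S := (H : groupType).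

Lemma Gammaz_isometry A : gl2_set (Gammaz R) A ->
  forall v, enorm (A *m v) = enorm v.
Proof. by move=> [i _ <-] v; exact: enorm_rot. Qed.

Local Notation translation := (@translation R (Gammaz R)).

Lemma Gammaz_set_rot (z : int) : gl2_set (Gammaz R) (rot_mx (Num.sqrt 2 *
    z%:~R)).
Proof. by exists z. Qed.

Definition rotation (z : int) : H :=
  (exist _ (rot_mx (Num.sqrt 2 * z%:~R)) (mem_set (Gammaz_set_rot z)), 0).

(** With both coordinates of the vector equal to [1], the cosine of a rotation
fixing it is read off by adding two linear equations, see [rot_fixes]. *)
Definition small_vec N i : 'cV[R]_2 :=
  rot_mx (Num.sqrt 2 * i%:~R) *m (2^-1 ^+ N *: const_mx 1).

Lemma rotation_translation (i : nat) N :
  (rotation i * translation (small_vec N 0))%g =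
  (translation (small_vec N i) * rotation i)%g.
Proof.
congr pair; first by apply: val_inj; rewrite /= mul1mx mulmx1.
by rewrite /= add0r mulmx0 addr0 /small_vec mulr0 Defs.rot0 mul1mx.
Qed.

Lemma small_vec_double N i : small_vec N i *+ 2 ^ N = small_vec 0 i.
Proof.
rewrite /small_vec -scaler_nat scalemxAr scalerA natrX exprVn mulfV ?scale1r
  ?expr0 ?scale1r // expf_neq0.
Qed.

Lemma enorm_small_vec N i :
  enorm (small_vec N i) = 2^-1 ^+ N * enorm (const_mx 1 : 'cV[R]_2).
Proof.
by rewrite enorm_rot enormZ ger0_norm // exprn_ge0 // invr_ge0.
Qed.

Lemma rot_fixes (t : R) : rot_mx t *m const_mx 1 = const_mx 1 :> 'cV[R]_2 ->
  exists z : int, t = z%:~R.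
Proof.
move=> e; have := congr1 (fun M : 'cV[R]_2 => M ord0 ord0) e.
have := congr1 (fun M : 'cV[R]_2 => M ord_max ord0) e.
rewrite !mxE !big_ord_recl !big_ord0 !mxE /= !mulr1 !addr0 => h1 h2.
by apply: cos2pi_eq1; lra.
Qed.

Lemma small_vec_neq (i i' : nat) : (i < i')%N -> small_vec 0 i' -
    small_vec 0 i != 0.
Proof.
move=> ii'; rewrite subr_eq0; apply/eqP =>
  /(congr1 (mulmx (rot_mx (- (Num.sqrt 2 * i%:~R))))).
rewrite /small_vec !mulmxA !Defs.rotD addNr Defs.rot0 mul1mx expr0 scale1r.
have -> : - (Num.sqrt 2 * i%:~R) + Num.sqrt 2 * i'%:~R = Num.sqrt 2 * (i' -
  i)%N%:R :> R.
  by rewrite natrB ?(ltnW ii') // -!pmulrn; ring.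
move=> /rot_fixes[z]; rewrite (pmulrn _ (i' - i)) => /sqrt2_irrational/eqP.
by rewrite eqz_nat subn_eq0 leqNgt ii'.
Qed.

Let gen_code := (nat * nat * bool + nat * bool)%type.

(** The eventually constant sequences used by the argument are the products of
these generators, each started at some index. *)
Definition generator (c : gen_code) : S :=
  match c with
  | inl (N, i, b) => translation (if b then - small_vec N i else small_vec N i)
  | inr (i, b) => if b then (rotation i)^-1%g else rotation i
  end.

Definition from_step (n : nat) (s : S) : nat -> S :=
  fun i => if (n <= i)%N then s else 1%g.

Definition word_seq (w : seq (nat * gen_code)) : nat -> S :=
  foldr (fun a => seq_mul (from_step a.1 (generator a.2))) (seq_one S) w.

Definition enum_word (a : nat) : nat -> S := word_seq (odflt [::] (unpickle a)).

Lemma Delta_word w : Delta enum_word (word_seq w).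
Proof. by exists (pickle w); rewrite // /enum_word pickleK. Qed.

Lemma word_seq_cat w w' : word_seq (w ++ w') =
    seq_mul (word_seq w) (word_seq w').
Proof. by elim: w => [|a w IH] /=; rewrite ?seq_mul1 // IH seq_mulA. Qed.

Lemma Delta_wordM f g : Delta enum_word f -> Delta enum_word g ->
  Delta enum_word (seq_mul f g).
Proof. by move=> [a _ <-] [b _ <-]; rewrite -word_seq_cat;
  exact: Delta_word. Qed.

Lemma word_seq1 n c : word_seq [:: (n, c)] = from_step n (generator c).
Proof. by apply/funext => i; rewrite /= /seq_mul mulg1. Qed.

Lemma word_seq_eventually w : exists K c, forall i, (K <= i)%N ->
    word_seq w i = c.
Proof.
elim: w => [|a w [K [c hc]]] /=; first by exists 0%N, 1%g.
exists (maxn K a.1), (generator a.2 * c)%g => i.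
by rewrite geq_max => /andP[Ki ai]; rewrite /seq_mul hc // /from_step ai.
Qed.

Section NoReduction.
Variables (k : nat) (k0 : (0 < k)%N).
Local Notation G := (semidirect (Gamma R k)).
Variable theta : {ptws nat -> H} -> {ptws nat -> G}.
Hypothesis theta_borel : borel_map theta.
Hypothesis theta_red : forall x y, E_rel x y <-> E_rel (theta x) (theta y).

Let dG := sdist_metric (@Gamma_isometry R k).

Lemma Cauchy_pair_cvgn (f x : nat -> H) :
  Cauchy_pair (@sdist R (Gamma R k)) theta (seq_mul f x) x <-> cvgn f.
Proof.
rewrite /Cauchy_pair -(cvgn_sdist (@Gamma_isometry R k)).
have := theta_red (seq_mul f x) x; rewrite /E_rel /=.
have -> : (fun n => (seq_mul f x n * (x n)^-1)%g) = f.
  by apply/funext => n; rewrite /seq_mul mulgK.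
by move=> h; split=> /h.
Qed.

(** The hypotheses of [no_Cauchy_reduction] hold for the two semidirect
products. *)
Lemma no_borel_reduction : False.
Proof.
pose step_vec := small_vec; pose r i := rotation i%:Z : S.
apply: (@no_Cauchy_reduction R S G (@sdist R (Gamma R k)) dG theta enum_word _
  Delta_wordM
  (grid R k) (@grid_dense R k) _ _ translation k step_vec r (@translationD R
    (Gammaz R))).
- exact: (Delta_word [::]).
- move=> m c e e0.
  have oB : open [set y : {ptws nat -> G} | sdist (y m) c < e].
    apply: (@open_comp _ _ (fun y : {ptws nat -> G} =>
      y m) [set y : G | sdist y c < e]).
      by move=> y _; exact: proj_continuous.
    exact: sdist_ball_open (@Gamma_isometry R k) _ _.
  exact: borel_map_Baire theta_borel oB.
- by move=> i N; exact: rotation_translation.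
- move=> n N i; have := Delta_word [:: (n, inl (N, i, false))].
  rewrite word_seq1 /Delta_shift; congr (Delta _ _); apply/funext => a.
  by rewrite /from_step /step; case: ifP.
- move=> n N i; have := Delta_word [:: (n, inl (N, i, true))].
  rewrite word_seq1 /Delta_shift; congr (Delta _ _); apply/funext => a.
  by rewrite /from_step /step; case: ifP.
- by move=> j i; have := Delta_word [:: (j, inr (i, false))]; rewrite word_seq1.
- by move=> j i; have := Delta_word [:: (j, inr (i, true))]; rewrite word_seq1.
- move=> f x [a _ <-]; apply/Cauchy_pair_cvgn/cvg_ex.
  have [K [c hc]] := word_seq_eventually (odflt [::] (unpickle a)).
  exists c; apply: cvg_near_cst; exists K => // i; exact: hc.
- exact: grid_bounded.
- exact: Gamma_conj_pigeonhole.
- exact: small_vec_double.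
- move=> p v x vP pP; apply/Cauchy_pair_cvgn/(cvgn_sdist Gammaz_isometry) =>
  e e0.
  set e1 : 'cV[R]_2 := const_mx 1.
  have [|K hK] := @delayed_sum_Cauchy R (enorm e1) p v _ e e0.
    move=> j; have [N [i [jN _ ->]]] := vP j; rewrite enorm_small_vec mulrC.
    rewrite ler_wpM2l ?enorm_ge0 // ler_wiXn2l // ?invr_ge0 // invf_le1 //.
    by rewrite ler1n.
  exists K => m m' Km Km'; apply: le_lt_trans (hK m m' Km Km').
  exact: sdist_same.
- move=> i i' f x ii' i'k hf /Cauchy_pair_cvgn /(cvgn_sdist Gammaz_isometry).
  move=> /(_ 1 ltr01)[K hK].
  set w := step_vec 0%N i' - step_vec 0%N i in hf.
  have w0 : 0 < enorm w.
    rewrite lt_neqAle enorm_ge0 andbT eq_sym; apply/eqP => /enorm_eq0/eqP.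
    by apply/negP/small_vec_neq.
  pose C := \sum_(m < K.+1) enorm (f m) + 1.
  have fC n : enorm (f n) <= C.
    have C0 (m : 'I_K.+1) : enorm (f m) + 1 <= C.
      rewrite lerD2r (bigD1 m) //= lerDl; apply: sumr_ge0 => *.
      exact: enorm_ge0.
    have [nK|Kn] := leqP n K.
      by have := C0 (Ordinal (nK : (n < K.+1)%N)); rewrite /=; lra.
    have [_ /= h] := sdist_lt1 (lexx 1) (hK n K (ltnW Kn) (leqnn _)).
    have := C0 ord_max; have := enormD (f n - f K) (f K).
    by rewrite subrK /=; lra.
  have [n fn] := hf (Num.bound (C / enorm w)).
  have := fC n; rewrite fn enorm_muln -ler_pdivlMl // mulrC leNgt.
  apply/negP/negPn; apply: archi_boundP;
    rewrite mulr_ge0 ?invr_ge0 ?enorm_ge0 //.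
  by rewrite addr_ge0 // sumr_ge0 // => *; exact: enorm_ge0.
Qed.

End NoReduction.
End Source.

(** * Identity components and their inner automorphisms *)

Section SemidirectComponent.
Variables (R : realType) (L : gl2_subgroup R).
Local Notation G := (semidirect L).
Local Notation G0 := (identity_component_set (G := G)).

(** The elements with trivial rotation part form an open and closed set. *)
Lemma component_fst (x : G) : G0 x -> val x.1 = 1%:M.
Proof.
move=> [A [A1 _ cA] Ax].
have fst_open (B : set G) : (forall y z, y.1 = z.1 -> B y -> B z) -> open B.
  move=> hB; rewrite openE => y By; rewrite /interior.
  by apply: filterS (fst_near y) => z zy; apply: hB By.
pose B := [set y : G | y.1 = (1%g : G).1].
suff AB : A `&` B = A by move: Ax; rewrite -AB => -[_ ->].
apply: cA; first by exists 1%g.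
  by exists B => //; apply: fst_open => y z yz; rewrite /B /= yz.
exists B => //; rewrite -[B]setCK; apply: open_closedC.
by apply: fst_open => y z yz; rewrite /B /= yz.
Qed.

Lemma component_translation v : G0 (translation L v).
Proof.
have cont : continuous (fun t : R => translation L (t *: v) : G).
  move=> t U /nbhs_sdist[e e0 eU].
  have e1 : 0 < e / (enorm v + 1).
    by rewrite divr_gt0 // ltr_wpDl // enorm_ge0.
  apply/nbhs_ballP; exists (e / (enorm v + 1)) => // s; rewrite /ball /= => ts.
  apply: eU; apply: le_lt_trans (sdist_same _) _ => //=.
  rewrite -scalerBl enormZ; move: ts; rewrite ltr_pdivlMr => [h|].
    by apply: le_lt_trans h; rewrite ler_wpM2l // lerDl.
  by rewrite ltr_wpDl // enorm_ge0.
exists ((fun t : R => translation L (t *: v) : G) @` `[0, 1]).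
  split=> //.
    by exists 0; rewrite /= ?in_itv /= ?lexx ?ler01 // scale0r.
  apply: connected_continuous_connected; first exact: segment_connected.
  exact: continuous_subspaceT.
by exists 1; rewrite /= ?in_itv /= ?lexx ?ler01 // scale1r.
Qed.

Definition component_elt v : identity_component G :=
  exist _ (translation L v) (mem_set (component_translation v)).

Lemma component_eltE (x : identity_component G) : x = component_elt (val x).2.
Proof.
case: x => -[A t] xP; have /= A1 := component_fst (set_mem xP).
by apply: val_inj; rewrite /= /translation (_ : A = (1%g : G).1) //;
  exact: val_inj.
Qed.

Lemma iota_component_elt (u : G) v :
  iota_conj u (component_elt v) = component_elt (val u.1 *m v).
Proof. by apply: val_inj; rewrite /= conj_translation. Qed.

Lemma component_elt_inj : injective component_elt.
Proof. by move=> v w /(congr1 (fun x => (val x).2)). Qed.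

End SemidirectComponent.

Section NoIsomorphism.
Variables (R : realType) (k : nat).
Hypothesis k2 : (2 <= k)%N.
Local Notation G := (semidirect (Gamma R k)).
Local Notation H := (semidirect (Gammaz R)).

Lemma iter_rot (t : R) n v : iter n (mulmx (rot_mx t)) v = rot_mx (t *
    n%:R) *m v :> 'cV[R]_2.
Proof.
elim: n => [|n IH]; first by rewrite mulr0 Defs.rot0 mul1mx.
by rewrite iterS IH mulmxA Defs.rotD mulrS mulrDr mulr1.
Qed.

(** If [iota_conj h] is conjugate to [iota_conj u], its [k]-th power is the
identity, so [k] times the angle of [h] is an integer and [h] is a translation;
but translations act trivially on the component, and [u] does not. *)
Lemma no_conjugating_isomorphism :
  ~ exists (phi : identity_component G -> identity_component H)
           (phiV : identity_component H -> identity_component G),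
      topological_isomorphism phi phiV /\
      [set phi \o iota \o phiV | iota in @Inn G] `<=` @Inn H.
Proof.
move=> [phi [phiV [[_ phiK phiVK _ _] incl]]].
have k0 : k%:R != 0 :> R by rewrite pnatr_eq0 -lt0n ltnW.
pose u : G := (exist _ (rot_mx (1%:R / k%:R)) (mem_set (@Gamma_set_rot R k 1
  (ltnW k2))), 0).
have [h _ hE] : Inn (phi \o iota_conj u \o phiV).
  by apply: incl; exists (iota_conj u) => //; exists u.
have iota_h x : iota_conj h x = phi (iota_conj u (phiV x)).
  by rewrite hE.
have [z _ hz] := valL h.
pose eG := @component_elt R (Gamma R k).
pose eH := @component_elt R (Gammaz R).
have iter_u n v : iter n (iota_conj u) (eG v) = eG (rot_mx (1%:R / k%:R *
  n%:R) *m v).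
  by rewrite -iter_rot; elim: n => //= n ->; rewrite iota_component_elt.
have iter_h n v : iter n (iota_conj h) (eH v) = eH (rot_mx (Num.sqrt 2 *
  z%:~R * n%:R) *m v).
  by rewrite -iter_rot; elim: n => //= n ->; rewrite iota_component_elt hz.
have iter_hu n x : iter n (iota_conj h) x = phi (iter n (iota_conj u) (phiV x)).
  by elim: n => [|n IH] /=; rewrite ?phiVK // IH iota_h phiK.
have z0 : z = 0.
  have := iter_hu k (eH (const_mx 1)); rewrite iter_h (component_eltE (phiV _)).
  have rot1 : rot_mx (1 : R) = 1%:M by have := rotD1 (0 : R);
    rewrite add0r Defs.rot0.
  rewrite iter_u divfK // rot1 mul1mx.
  rewrite /eG -component_eltE phiVK => /component_elt_inj; rewrite -mulrA.
  have -> : z%:~R * k%:R = (z * k%:Z)%:~R :> R by rewrite intrM -pmulrn.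
  move=> /rot_fixes[y /sqrt2_irrational/eqP].
  rewrite mulf_eq0 => /orP[/eqP//|]; rewrite eqz_nat => /eqP k00.
  by move: k2; rewrite k00.
have := iter_hu 1%N (phi (eG (const_mx 1))) => /=.
rewrite phiK (component_eltE (phi _)) iota_component_elt -hz z0 mulr0 Defs.rot0.
rewrite mul1mx -component_eltE => /(can_inj phiK).
rewrite iota_component_elt => /component_elt_inj/esym/rot_fixes[y].
rewrite mul1r => e; have : (1 : R) = (y * k%:Z)%:~R.
  by rewrite intrM -pmulrn -e mulVf.
move=> /eqP; rewrite -[1]/(1%:~R) eqr_int => /eqP e1.
have : (k %| 1)%N by rewrite -[1%N]/(absz 1) e1 abszM dvdn_mull.
by rewrite dvdn1 => /eqP k1; move: k2; rewrite k1.
Qed.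

End NoIsomorphism.

(** * The reduction from finitely many rotations *)

Section RotationApproximation.
Variable R : realType.

Lemma rotDz (t : R) (z : int) : rot_mx (t + z%:~R) = rot_mx t.
Proof.
have nat_period n (s : R) : rot_mx (s + n%:R) = rot_mx s.
  elim: n => [|n IH]; first by rewrite addr0.
  by rewrite mulrSr addrA rotD1.
case: z => n; first exact: nat_period.
by rewrite NegzE intrN -[LHS](nat_period n.+1) -pmulrn subrK.
Qed.

Lemma rotC (s t : R) : rot_mx s *m rot_mx t = rot_mx t *m rot_mx s.
Proof. by rewrite !Defs.rotD addrC. Qed.

(** [(sqrt 2 - 1) ^ n] is an integral combination of [sqrt 2] and [1]. *)
Lemma sqrt2_pow_approx (n : nat) : exists a b : int,
  0 < Num.sqrt (2 : R) * a%:~R + b%:~R <= 2^-1 ^+ n.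
Proof.
have s2 : Num.sqrt (2 : R) ^+ 2 = 2 by rewrite sqr_sqrtr.
have s0 : 0 <= Num.sqrt (2 : R) by exact: sqrtr_ge0.
have d0 : 0 < Num.sqrt 2 - 1 :> R by rewrite expr2 in s2; nra.
have d1 : Num.sqrt 2 - 1 <= 2^-1 :> R by rewrite expr2 in s2; nra.
suff [a [b e]] : exists a b : int,
    Num.sqrt (2 : R) * a%:~R + b%:~R = (Num.sqrt 2 - 1) ^+ n.
  exists a, b; rewrite e exprn_gt0 //=.
  by rewrite lerXn2r // nnegrE ?invr_ge0 // ltW.
elim: n => [|n [a [b IH]]]; first by exists 0, 1; rewrite mulr0 add0r.
exists (b - a), (2 * a - b); rewrite exprS -IH.
rewrite !intrB intrM; move: s2; move: (Num.sqrt 2) => s s2.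
rewrite (_ : _ * (s * a%:~R + _) = s ^+ 2 * a%:~R + s * (b%:~R - a%:~R) -
  b%:~R).
  by rewrite s2; ring.
by ring.
Qed.

Lemma rot_approx (t : R) (n : nat) : exists z : int, exists s : R,
  rot_mx (Num.sqrt 2 * z%:~R) = rot_mx t *m rot_mx s /\ `|s| <= 2^-1 ^+ n.
Proof.
have [a [b /andP[d0 d1]]] := sqrt2_pow_approx n.
set d := _ + _ in d0 d1; set m := Num.floor (t / d).
exists (m * a)%R, (m%:~R * d - t); split.
  rewrite Defs.rotD addrC subrK /d mulrDr -!intrM mulrCA -intrM rotDz.
  by rewrite mulrC.
apply: le_trans d1; have := floor_itv (t / d); rewrite -/m intrD1.
rewrite ler_pdivlMr // ltr_pdivrMr // mulrDl mul1r => /andP[h1 h2].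
by rewrite ler_norml; apply/andP; split; lra.
Qed.

End RotationApproximation.

Section Lift.
Variables (R : realType) (k : nat).
Local Notation G := (semidirect (Gamma R k)).
Local Notation H := (semidirect (Gammaz R)).
Local Notation rots := (set_type (Gamma R k)).

Lemma approx_family : exists (approx_index : nat -> rots ->
    int) (approx_error : nat -> rots -> R),
  forall n A, rot_mx (Num.sqrt 2 * (approx_index n A)%:~R) = val A *m
    rot_mx (approx_error n A) /\
    `|approx_error n A| <= 2^-1 ^+ n.
Proof.
have /choice[f hf] : forall nA : nat * rots, exists ze : int * R,
    rot_mx (Num.sqrt 2 * ze.1%:~R) = val nA.2 *m rot_mx ze.2 /\
    `|ze.2| <= 2^-1 ^+ nA.1.
  move=> [n A]; have [i _ <-] := set_mem (valP A).
  by have [z [s h]] := rot_approx (i%:R / k%:R : R) n; exists (z, s).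
exists (fun n A => (f (n, A)).1), (fun n A => (f (n, A)).2) => n A.
exact: (hf (n, A)).
Qed.

Variables (approx_index : nat -> rots -> int) (approx_error : nat -> rots -> R).
Hypothesis approx : forall n A,
  rot_mx (Num.sqrt 2 * (approx_index n A)%:~R) = val A *m
    rot_mx (approx_error n A) /\
    `|approx_error n A| <= 2^-1 ^+ n.

(** They determine the rotation parts of [x] up to a constant left factor. *)
Definition jump (x : nat -> G) n : rots := ((x n)^-1 * x n.+1)%g.1.

Lemma val_jump x n : val (jump x n) = invmx (val (x n).1) *m val (x n.+1).1.
Proof. by []. Qed.

(** The rotations of [Gammaz] are powers of one of them, so the product of the
approximations of the jumps has the sum of their exponents as exponent. *)
Definition lift_index (x : nat -> G) n : int := \sum_(j <
    n) approx_index j (jump x j).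

Definition lift_seq (x : nat -> G) n : H :=
  (rotation R (lift_index x n) *
   translation (Gammaz R) (invmx (val (x n).1) *m (x n).2))%g.

Lemma val_Gamma (A : rots) : exists t : R, val A = rot_mx t.
Proof. by have [i _ <-] := set_mem (valP A); eexists. Qed.

(** Distinct rotations in the finite group are a fixed distance apart, so they
have distinct approximations from some index on. *)
Lemma separation : exists N, forall n A B, (N <= n)%N ->
  approx_index n A = approx_index n B -> A = B.
Proof.
have k0 : 0 < 2 * k.+1%:R :> R by rewrite mulr_gt0 // ltr0n.
have k0V : 0 < (2 * k.+1%:R : R)^-1 by rewrite invr_gt0.
have [N hN] := invS_lt k0V.
exists N => n A B Nn eAB; apply: val_inj.
have [hA sA] := approx n A; have [hB sB] := approx n B.
rewrite -eAB hA in hB.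
have small (e : R) : `|e| <= (2^-1 : R) ^+ n -> `|e| * (2 * k.+1%:R) < 1.
  move=> en; rewrite -ltr_pdivlMr // mul1r; apply: le_lt_trans hN.
  apply: le_trans en _; apply: le_trans (half_expr_le _ _) _; exact: invS_le.
have {}sA := small _ sA; have {}sB := small _ sB.
have [i ik iE] := set_mem (valP A); have [j jk jE] := set_mem (valP B).
move: hB; rewrite -iE -jE !Defs.rotD => /(congr1 (fun M =>
  rot_mx (- (j%:R / k%:R + approx_error n B)) *m M)).
rewrite !Defs.rotD addNr Defs.rot0 => /rot_eq1[z hz].
case: (posnP k) => [k00|kp]; first by rewrite k00 invr0 !mulr0.
have k1 : k%:R != 0 :> R by rewrite pnatr_eq0 -lt0n.
have ez : (i%:Z - j%:Z - z * k%:Z)%:~R = (approx_error n B -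
  approx_error n A) * k%:R :> R.
  rewrite !intrB intrM -!pmulrn -hz; field.
  exact: k1.
have : `|(i%:Z - j%:Z - z * k%:Z)%:~R : R| < 1.
  rewrite ez.
  have kk : k%:R < k.+1%:R :> R by rewrite ltr_nat.
  have k0' : 0 < k%:R :> R by rewrite ltr0n.
  rewrite normrM (ger0_norm (ltW k0')).
  have := ler_normB (approx_error n B) (approx_error n A).
  have := normr_ge0 (approx_error n B); have := normr_ge0 (approx_error n A).
  by nra.
rewrite -intr_norm -[X in _ < X]/(1%:~R) ltr_int => lt1.
have e0 : i%:Z - j%:Z = z * k%:Z by apply/eqP; rewrite -subr_eq0 -normr_le0;
  lia.
have -> : i%:R / k%:R = j%:R / k%:R + z%:~R :> R.
  have := congr1 (fun a : int => a%:~R : R) e0;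
    rewrite intrB intrM -!pmulrn => e1.
  by rewrite -[i%:R](subrK j%:R) e1; field.
exact: rotDz.
Qed.

(** The rotation parts of the lift follow those of [x] up to a convergent
angle, because the errors of approximation are summable. *)
Lemma lift_angle x : exists2 q : nat -> R, cvgn q &
  forall n, rot_mx (Num.sqrt 2 * (lift_index x n)%:~R) = rot_mx (q n) *m
    val (x n).1.
Proof.
have [a0 a0E] := val_Gamma (x 0%N).1.
exists (fun n => \sum_(0 <= j < n) approx_error j (jump x j) - a0).
  apply/cauchy_cvgP/cauchy_exP => e e0.
  have e2 : 0 < e / 2 by lra.
  have [J hJ] := invS_lt e2.
  exists (\sum_(0 <= j < J) approx_error j (jump x j) - a0); exists J =>
    // n /= Jn.
  rewrite /ball /= [X in _ - (X - _)](@big_cat_nat _ _ _ J) //=.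
  set u := \sum_(0 <= j < J) _; set w := \sum_(J <= j < n) _.
  rewrite (_ : _ - _ = - w); last by ring.
  rewrite normrN; apply: le_lt_trans (ler_norm_sum _ _ _) _.
  apply: (@le_lt_trans _ _ (2 * 2^-1 ^+ J)).
    apply: le_trans (geometric_tail R J n); apply: ler_sum => j _.
    exact: (approx _ _).2.
  by have := half_expr_le R J; lra.
elim=> [|n IH].
  by rewrite /lift_index big_ord0 mulr0 big_geq // sub0r a0E !Defs.rotD addNr.
rewrite /lift_index big_ord_recr /= intrD mulrDr -Defs.rotD IH (approx n _).1.
rewrite val_jump big_nat_recr //= addrAC -[in RHS]Defs.rotD -!mulmxA;
  congr (_ *m _).
rewrite mulKVmx ?(val_unit (x n)) //.
by have [a ->] := val_Gamma (x n.+1).1; rewrite rotC.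
Qed.

Lemma cvg_rotated (q : nat -> R) (v : nat -> 'cV[R]_2) : cvgn q ->
  (forall i, cvgn (fun n => v n i ord0)) ->
  forall i, cvgn (fun n => (rot_mx (q n) *m v n) i ord0).
Proof.
move=> qc vc i.
have entry j : cvgn (fun n => rot_mx (q n) i j).
  have cq : cvgn (fun n => 2 * pi * q n) by apply: is_cvgMr.
  have cc : cvgn (fun n => cos (2 * pi * q n)).
    by apply/cvg_ex; eexists; apply: continuous_cvg cq; exact: continuous_cos.
  have cs : cvgn (fun n => sin (2 * pi * q n)).
    by apply/cvg_ex; eexists; apply: continuous_cvg cq; exact: continuous_sin.
  have -> : (fun n => rot_mx (q n) i j) =
      if i == j then fun n => cos (2 * pi * q n) else
      if (i < j)%N then fun n => - sin (2 * pi * q n) else fun n => sin (2 *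
        pi * q n).
    by apply/funext => n; rewrite mxE; do 2?case: ifP.
  by case: ifP => // _; case: ifP => // _; exact: is_cvgN.
have -> : (fun n => (rot_mx (q n) *m v n) i ord0) = (fun n =>
    rot_mx (q n) i ord0 * v n ord0 ord0 + rot_mx (q n) i ord_max *
      v n ord_max ord0).
  apply/funext => n; rewrite mxE !big_ord_recl big_ord0 addr0.
  by congr (_ + rot_mx _ i _ * v n _ _); apply: val_inj.
by apply: is_cvgD; apply: is_cvgM.
Qed.

Lemma lift_ratio x y : exists2 q : nat -> R, cvgn q & forall n,
  val (lift_seq x n / lift_seq y n)%g.1 =
    rot_mx (Num.sqrt 2 * (lift_index x n - lift_index y n)%:~R) /\
  (lift_seq x n / lift_seq y n)%g.2 = rot_mx (q n) *m (x n / y n)%g.2.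
Proof.
have [q qc hq] := lift_angle x; exists q => // n; split.
  by rewrite /= !mulmx1 rotV Defs.rotD intrB mulrBr.
rewrite /= !mulmx1 !add0r hq -!mulmxA mulKVmx ?(val_unit (x n)) //.
by rewrite mulKmx ?rot_unit // mulmxDr mulmxN.
Qed.

(** In both directions the translation parts correspond by convergent rotations.
Constancy of the ratio of rotation parts is equality of the jumps; for the lifts
this is equality of the approximations, as an irrational rotation has infinite
order, and [separation] recovers the jumps. *)
Lemma lift_seq_reduction x y :
  cvgn (fun n => (x n / y n)%g) <-> cvgn (fun n =>
    (lift_seq x n / lift_seq y n)%g).
Proof.
have [q qc hq] := lift_ratio x y; split=> /cvgn_coord[[K hK] cc];
  apply/cvgn_coord; split.
- exists K => m Km; rewrite !(hq _).1; congr (rot_mx (_ * _%:~R)).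
  have ratio_const n : (K <= n)%N -> val (x n).1 = val (x K / y K)%g.1 *m
    val (y n).1.
    by move=> /hK <- /=; rewrite mulmxKV ?(val_unit (y n)).
  have jumps n : (K <= n)%N -> jump x n = jump y n.
    move=> Kn; apply: val_inj; rewrite !val_jump.
    apply: (can_inj (mulKmx (val_unit (x n))));
      rewrite mulKVmx ?(val_unit (x n)) //.
    rewrite (ratio_const n.+1 (leqW Kn)) (ratio_const n Kn).
    by move: (val (x K / y K)%g.1) => C;
      rewrite -mulmxA mulKVmx ?(val_unit (y n)).
  rewrite -(subnKC Km) /lift_index; elim: (m - K)%N => [|t IH];
    first by rewrite addn0.
  by rewrite addnS !big_ord_recr /= jumps ?leq_addr // -IH; ring.
- move=> i; under eq_fun do rewrite (hq _).2.
  exact: cvg_rotated.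
- have [N hN] := separation; exists (maxn N K) => m.
  have jumps n : (maxn N K <= n)%N -> jump x n = jump y n.
    rewrite geq_max => /andP[Nn Kn]; apply: (hN n) => //.
    have := hK n.+1 (leqW Kn); rewrite -(hK n Kn) !(hq _).1.
    rewrite /lift_index !big_ord_recr /=; set a := \sum_(_ < n) _; set b :=
      \sum_(_ < n) _.
    set u := approx_index _ _; set w := approx_index _ _.
    rewrite (_ : _ - _ = (a - b) + (u - w)); last by ring.
    rewrite (intrD _ (a - b)) mulrDr =>
      /(congr1 (mulmx (rot_mx (- (Num.sqrt 2 * (a - b)%:~R))))).
    rewrite !Defs.rotD addKr addNr Defs.rot0 =>
      /rot_eq1[z /sqrt2_irrational/eqP].
    by rewrite subr_eq0 => /eqP.
  move=> Km; rewrite -(subnKC Km); elim: (m - _)%N => [|t <-];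
    first by rewrite addn0.
  rewrite addnS /=; have := jumps _ (leq_addr t (maxn N K)).
  move=> /(congr1 val); rewrite !val_jump; move: (maxn N K + t)%N => n e.
  have := congr1 (fun M => val (x n).1 *m (M *m invmx (val (y n.+1).1))) e.
  by rewrite !mulmxA mulmxV ?(val_unit (x n)) // mul1mx => ->;
    rewrite mulmxK ?(val_unit (y n.+1)).
- move=> i; have cN : cvgn (fun n => - q n) by apply: is_cvgN.
  have := @cvg_rotated _ _ cN cc i;
    under eq_fun do rewrite (hq _).2 mulmxA Defs.rotD addNr Defs.rot0 mul1mx.
  by [].
Qed.

End Lift.

Section BorelLift.
Variables (R : realType) (k : nat).
Local Notation G := (semidirect (Gamma R k)).
Local Notation H := (semidirect (Gammaz R)).

Lemma continuous_borel_map (X Y : ptopologicalType) (f : X -> Y) :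
  continuous f -> borel_map f.
Proof.
move=> cf; rewrite /borel_map;
  apply: (@measurability _ _ (g_sigma_algebraType (@open X))
  (g_sigma_algebraType (@open Y)) setT f (@open Y)) => // _ [B oB <-].
rewrite setTI; apply: sub_sigma_algebra.
by apply: open_comp => // y _; exact: cf.
Qed.

Lemma ptws_continuous (X Y : ptopologicalType) (f : X -> {ptws nat -> Y}) :
  (forall n, continuous (fun x => f x n)) -> continuous f.
Proof.
move=> cf x; apply/cvg_sup => n U [V] [[W] oW <-] Wx WU; apply: (filterS WU).
by apply: (cf n x); exact: open_nbhs_nbhs.
Qed.

Variable approx_index : nat -> set_type (Gamma R k) -> int.

(** The rotation part of the [N]-th term of the lift depends only on the
rotation parts of the first terms of [x], which are locally constant. *)
Lemma lift_seq_continuous :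
  continuous (lift_seq approx_index : {ptws nat -> G} -> {ptws nat -> H}).
Proof.
apply: ptws_continuous => N x U /nbhs_sdist[e e0 eW].
have near_coord n (P : set G) : nbhs (x n) P ->
    \forall y \near (x : {ptws nat -> G}), P (y n).
  exact: proj_continuous.
have FF : Filter (nbhs (x : {ptws nat -> G})) by exact: nbhs_filter.
have near_fst : \forall y \near (x : {ptws nat -> G}),
    forall n : 'I_N.+1, (y (n : nat)).1 = (x (n : nat)).1.
  by apply: (filter_forall FF) => n; exact: (near_coord n _ (fst_near (x n))).
have near_snd : \forall y \near (x : {ptws nat -> G}),
    sdist (x N) (y N) < Num.min 1 e.
  apply: (near_coord N [set z | sdist (x N) z < Num.min 1 e]);
    apply/nbhs_sdist; exists (Num.min 1 e) => //.
  by rewrite lt_min ltr01.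
apply: (@filterS2 _ _ FF _ _ _ _ near_fst near_snd) =>
  y fst_eq /sdist_lt1[|_ xy].
  by rewrite ge_min lexx.
have {}fst_eq n : (n <= N)%N -> (y n).1 = (x n).1.
  by move=> nN; exact: (fst_eq (Ordinal (nN : (n < N.+1)%N))).
have jump_eq n : (n < N)%N -> jump y n = jump x n.
  by move=> nN; apply: val_inj; rewrite !val_jump !fst_eq // ltnW.
have index_eq : lift_index approx_index y N = lift_index approx_index x N.
  by apply: eq_bigr => j _; rewrite jump_eq.
apply: eW; apply: le_lt_trans (sdist_same _) _.
  by rewrite /= index_eq.
rewrite /= !add0r index_eq fst_eq // -!mulmxBr enorm_rot.
have [t ->] := val_Gamma (x N).1; rewrite rotV enorm_rot.
by apply: lt_le_trans xy _; rewrite ge_min lexx orbT.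
Qed.

End BorelLift.

Theorem theorem1p2 (R : realType) (k : nat) (hk : (2 <= k)%N) :
  let G : topologicalGroupType := semidirect (Gamma R k) in
  let H : topologicalGroupType := semidirect (Gammaz R) in
  strictly_borel_reducible (@E_rel G) (@E_rel H) /\
  ~ exists (phi : identity_component G -> identity_component H)
           (phiV : identity_component H -> identity_component G),
      topological_isomorphism phi phiV /\
      [set phi \o iota \o phiV | iota in @Inn G] `<=` @Inn H.
Proof.
move=> G H; split; last exact: no_conjugating_isomorphism.
split.
  have [approx_index [approx_error approx]] := approx_family R k.
  exists (lift_seq approx_index : {ptws nat -> G} -> {ptws nat -> H}).
    by apply: continuous_borel_map; exact: lift_seq_continuous.
  by move=> x y; exact: (lift_seq_reduction approx).
move=> [theta theta_borel theta_red].
exact: (no_borel_reduction (ltnW hk) theta_borel theta_red).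
Qed.
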